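(* Let $n\ge1$, let $B\subset\mathrm{SL}_n(\mathbb{C})$ be the Borel subgroup of upper triangular matrices and $\mathscr{X}_n$ the variety of complete quadrics in $\mathbb{P}^{n-1}$. Then $$b(\mathscr{X}_n)=\sum_{J}\sum_{w\in W^J}2^{a_J(w)+b_J(w)},$$ where $b(\mathscr{X}_n)$ is the number of $B$-orbits in $\mathscr{X}_n$, the outer sum is over all subsets $J\subseteq[n-1]=\{1,\dots,n-1\}$ containing no two consecutive integers, $a_J(w)$ is the number of descents $i$ of $w$ such that neither $i$ nor $i-1$ lies in $J$, and $b_J(w)$ is the number of descents $i$ of $w$ such that $w(i+1)<w(i-1)<w(i)$, $i-1\in J$ and $i\notin J$.
   Context: $\mathscr{X}_n$ is the closure of the image of $[A]\mapsto([\Lambda^1 A],\dots,[\Lambda^{n-1}A])\in\prod_{i=1}^{n-1}\mathbb{P}(\Lambda^i(\mathrm{Sym}_n))$, $A$ ranging over invertible symmetric complex $n\times n$ matrices (the wonderful embedding of $\mathrm{SL}_n/\widetilde{\mathrm{SO}}_n$), with $\mathrm{SL}_n$ acting via $g\cdot A=(g^\top)^{-1}Ag^{-1}$. $W=S_n$; for $J\subseteq[n-1]$, $W_J$ is the subgroup generated by the simple transpositions $s_j=(j,j+1)$, $j\in J$, and $W^J$ is the set of minimal length representatives of the left cosets $W/W_J$ (length = number of inversions). A descent of $w\in S_n$ is an index $i\in[n-1]$ with $w(i)>w(i+1)$. *)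

(* Defs.v *)
From HB Require Import structures.
From mathcomp Require Import all_boot all_order all_fingroup all_algebra.
From mathcomp Require Import mpoly complex.
From mathcomp Require Import boolp classical_sets functions cardinality reals.

Set Implicit Arguments.
Unset Strict Implicit.
Unset Printing Implicit Defensive.

Import GRing.Theory.
Local Open Scope ring_scope.

Section MultiProjective.

Variables (F : fieldType) (K : finType) (N : K -> nat).

(* A point of the product over k of the projective spaces P('M_(N k)) is a
   family of lines; the condition \dim (x k) = 1 is carried separately, by
   is_multipoint. *)
Definition multipoint := forall k : K, {vspace 'M[F]_(N k)}.

Definition is_multipoint (x : multipoint) := forall k, \dim (x k) = 1%N.

Definition entry := {k : K & ('I_(N k) * 'I_(N k))%type}.

Definition coords (v : forall k, 'M[F]_(N k)) (j : 'I_#|{: entry}|) : F :=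
  let c := enum_val j in v (tag c) (tagged c).1 (tagged c).2.

Definition multihomogeneous (p : {mpoly F[#|{: entry}|]}) :=
  exists d : K -> nat, forall m, m \in msupp p -> forall k,
    (\sum_(j < #|{: entry}| | tag (enum_val j) == k) m j)%N = d k.

Definition vanishes_at (p : {mpoly F[#|{: entry}|]}) (x : multipoint) :=
  forall v : (forall k, 'M[F]_(N k)),
    (forall k, x k = <[v k]>%VS) -> p.@[coords v] = 0.

Definition zariski_closure (S : set multipoint) : set multipoint :=
  fun x => is_multipoint x /\
    forall p, multihomogeneous p ->
      (forall y, S y -> vanishes_at p y) -> vanishes_at p x.

End MultiProjective.

(* The strictly increasing maps 'I_k -> 'I_n encode the k-subsets of [n], that
   is, the standard basis of the k-th exterior power of F^n. *)
Definition incr (k n : nat) :=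
  {f : {ffun 'I_k -> 'I_n} |
     [forall a : 'I_k, forall b : 'I_k, (a < b)%N ==> (f a < f b)%N]}.

Definition ext_dim (k n : nat) := #|{: incr k n}|.

Definition basis_incr (k n : nat) (a : 'I_(ext_dim k n)) : {ffun 'I_k -> 'I_n} :=
  val (enum_val (a : 'I_#|{: incr k n}|)).

Definition ext_pow (F : fieldType) (k n : nat) (A : 'M[F]_n) :
    'M[F]_(ext_dim k n) :=
  \matrix_(a, b) \det (mxsub (basis_incr a) (basis_incr b) A).

Section CompleteQuadrics.

Variables (F : fieldType) (n : nat).

(* The index k : 'I_n.-1 stands for the exterior degree k.+1 in 1, ..., n-1. *)
Definition quadric_point :=
  multipoint F (fun k : 'I_n.-1 => ext_dim k.+1 n).

Definition all_symmetric (x : quadric_point) :=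
  forall k, {in x k, forall X, X^T = X}.

Definition ext_lines (A : 'M[F]_n) : quadric_point :=
  fun k => <[ext_pow k.+1 A]>%VS.

Definition nondeg_quadrics : set quadric_point :=
  fun x => exists A : 'M[F]_n, [/\ A^T = A, A \in unitmx & x = ext_lines A].

(* all_symmetric places the points in the product of the P(Sym). *)
Definition complete_quadrics : set quadric_point :=
  fun x => all_symmetric x /\ zariski_closure nondeg_quadrics x.

Definition borel : set 'M[F]_n :=
  fun g => \det g = 1 /\ (forall i j : 'I_n, (j < i)%N -> g i j = 0).

(* The action on lines induced by g . A = (g^T)^-1 A g^-1 through the
   multiplicativity of exterior powers. *)
Definition quadric_act (g : 'M[F]_n) (x : quadric_point) : quadric_point :=
  fun k => (linfun (fun X => ext_pow k.+1 (invmx g^T) *m X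
                               *m ext_pow k.+1 (invmx g)) @: x k)%VS.

Definition borel_orbit (x : quadric_point) : set quadric_point :=
  fun y => exists2 g, borel g & y = quadric_act g x.

Definition borel_orbits : set (set quadric_point) :=
  (borel_orbit @` complete_quadrics)%classic.

End CompleteQuadrics.

Arguments nondeg_quadrics : clear implicits.
Arguments complete_quadrics : clear implicits.
Arguments borel : clear implicits.
Arguments borel_orbits : clear implicits.

(* Throughout, i : 'I_n.-1 stands for the index i.+1 of [n-1] = {1, ..., n-1};
   pos i and pos_succ i are the corresponding elements i.+1 and i.+2 of [n],
   represented in 'I_n by i and i.+1. *)
Section Combinatorics.

Variable n : nat.
Implicit Types (i j : 'I_n.-1) (J : {set 'I_n.-1}) (w : 'S_n).

Definition pos i : 'I_n := widen_ord (leq_pred n) i.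

Definition pos_succ i : 'I_n :=
  Ordinal (etrans (esym (ltn_predRL i n)) (ltn_ord i)).

Definition simple_transp i : 'S_n := tperm (pos i) (pos_succ i).

Definition parabolic J : {group 'S_n} :=
  <<[set simple_transp j | j in J]>>%G.

Definition perm_length w : nat :=
  #|[set p : 'I_n * 'I_n | (p.1 < p.2)%N & (w p.2 < w p.1)%N]|.

(* In 'S_n, (u * w) x = w (u x): the left coset w W_J for composition of
   functions is the set of products u * w with u in parabolic J. *)
Definition min_coset_reps J : {set 'S_n} :=
  [set w | [forall u in parabolic J,
              (perm_length w <= perm_length (u * w)%g)%N]].

Definition descent w i : bool := (w (pos_succ i) < w (pos i))%N.

Definition no_consecutive J : bool :=
  [forall i in J, forall j in J, (j : nat) != i.+1].

Definition pred_in J i : bool := [exists j in J, j.+1 == i :> nat].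

Definition a_stat J w : nat :=
  #|[set i | [&& descent w i, i \notin J & ~~ pred_in J i]]|.

Definition b_stat J w : nat :=
  #|[set i | [&& descent w i, i \notin J &
      [exists j in J, [&& j.+1 == i :> nat,
                          (w (pos_succ i) < w (pos j))%N &
                          (w (pos j) < w (pos i))%N]]]]|.

End Combinatorics.

(* Main.v *)
(* Borel orbits on complete quadrics correspond to pairs (be, s) of an ordered set
   partition of [n], given by its level function be, and an involution s preserving
   the blocks. The normal form attached to (be, s) is the limit, as e tends
   to 0, of T P T with P the permutation matrix of s and T = diag (e ^ be);
   its k-th component is the restriction of the k-th exterior power of P to the
   k-subsets of minimal be-weight.

   Every point of the closure is such a limit up to congruence: after a generic
   change of frame all leading coefficients are nonzero (the span of the matrices
   u u^T, u decomposable, is stable under complex conjugation, so a nonzero element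
   of it cannot vanish on all decomposable vectors), and on this chart the relations
   given by the decomposition A = U^T D U extend to the closure. Bruhat decomposition
   of the frame and symmetric Gaussian elimination inside the blocks then reach a
   normal form. Two normal forms in the same orbit coincide, since a triangular
   congruence between partial monomial matrices preserves their supports.

   Counting: list the cycles of s block by block, and inside each block by decreasing
   minima. This gives a set J of 2-cycles, a minimal coset representative w, and the
   set of those descents of cycle minima that lie inside a block; the latter is an
   arbitrary subset of a set with a_J(w) + b_J(w) elements. *)
Require Import Defs.
From HB Require Import structures.
From mathcomp Require Import all_boot all_order all_fingroup all_algebra.
From mathcomp Require Import mpoly complex.
From mathcomp Require Import boolp classical_sets functions cardinality reals.
From mathcomp Require Import ring zify.

Set Implicit Arguments.
Unset Strict Implicit.
Unset Printing Implicit Defensive.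

Import Order.TTheory GRing.Theory Num.Theory.
Local Open Scope ring_scope.

(** * Strictly increasing maps as subsets of [n] *)

Section IncreasingMaps.

(** Membership in the closure is known only through multihomogeneous polynomials, so no curve
    tending to a given point is available. The relations that hold in the limit are therefore
    written as identities between quotients of multidegree 0 on the chart; this is why inverses
    appear as adjugates and diagonal entries only through ratios of consecutive ones, whose zeros
    mark the borders of the blocks. The frame that reaches the chart is arbitrary. In its Bruhat
    decomposition the upper triangular factor is absorbed by the orbit, the permutation relabels the
    levels, and the lower triangular factor acts on the limit through its diagonal blocks only,
    because levels grow with the index on the chart. The power of 2 counts the choices, at each
    eligible descent, between starting a new block and staying in the current one; at every other
    position outside J a new block must start. *)

Lemma rank_perm (k : nat) (r : rel 'I_k) :
  irreflexive r -> transitive r ->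
  (forall i j, i != j -> r i j || r j i) ->
  exists s : 'S_k, forall i j, (s i < s j)%N = r i j.
Proof.
move=> irr tr tot.
have rk_lt i : (#|[pred j | r j i]| < k)%N.
  rewrite -[X in (_ < X)%N]card_ord; apply: proper_card.
  by apply/properP; split; [apply/fintype.subsetP | exists i; rewrite // inE irr].
have rkP i j : r i j -> (#|[pred l | r l i]| < #|[pred l | r l j]|)%N.
  move=> rij; apply: proper_card; apply/properP; split.
    by apply/fintype.subsetP=> l; rewrite !inE => rli; apply: tr rli rij.
  by exists i; rewrite !inE ?irr.
have rk_mono i j : (Ordinal (rk_lt i) < Ordinal (rk_lt j))%N = r i j.
  apply/idP/idP => /= [lt_ij|/rkP//].
  have [eij|/tot/orP[//|/rkP]] := eqVneq i j; first by rewrite eij ltnn in lt_ij.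
  by rewrite ltnNge ltnW.
have rk_inj : injective (fun i => Ordinal (rk_lt i)).
  move=> i j eij; apply/eqP/negPn/negP => /tot.
  by rewrite -!rk_mono eij ltnn.
by exists (perm rk_inj) => i j; rewrite !permE rk_mono.
Qed.

Variables k n : nat.
Implicit Types (a b : 'I_(ext_dim k n)) (f : 'I_k -> 'I_n).

Lemma basis_incr_mono a i j : (basis_incr a i < basis_incr a j)%N = (i < j)%N.
Proof.
have incrP (i' j' : 'I_k) : (i' < j')%N -> (basis_incr a i' < basis_incr a j')%N.
  by have /forallP/(_ i')/forallP/(_ j')/implyP := valP (enum_val a).
apply/idP/idP => [|/incrP//]; case: (ltngtP i j) => // [/incrP|/ord_inj ->].
  by move=> /ltnW; rewrite leqNgt => /negbTE ->.
by rewrite ltnn.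
Qed.

Lemma basis_incr_inj a : injective (basis_incr a).
Proof.
move=> i j eij; apply/eqP; rewrite -val_eqE /= eqn_leq.
by rewrite [(i <= j)%N]leqNgt [(j <= i)%N]leqNgt -!(basis_incr_mono a) eij ltnn.
Qed.

Lemma leq_basis_incr a (i : 'I_k) : (i <= basis_incr a i)%N.
Proof.
case: i => m; elim: m => [|m IHm] lt_mk //=.
have lt_mk' : (m < k)%N by apply: ltnW.
apply: leq_ltn_trans (IHm lt_mk') _; rewrite basis_incr_mono /=; exact: ltnSn.
Qed.

Lemma basis_incr_ex f : (forall i j : 'I_k, (i < j)%N -> (f i < f j)%N) ->
  exists a, basis_incr a =1 f.
Proof.
move=> f_incr.
have fP : [forall a : 'I_k, forall b : 'I_k, (a < b)%N ==> ([ffun i => f i] a < [ffun i => f i] b)%N].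
  by apply/forallP=> a; apply/forallP=> b; apply/implyP=> lt_ab; rewrite !ffunE f_incr.
pose P (g : {ffun 'I_k -> 'I_n}) :=
  [forall a : 'I_k, forall b : 'I_k, (a < b)%N ==> (g a < g b)%N].
exists (enum_rank (exist P [ffun i => f i] fP : incr k n)) => i.
by rewrite /basis_incr enum_rankK /= ffunE.
Qed.

Lemma perm_incr_id (s : 'S_k) : (forall i j : 'I_k, (i < j)%N -> (s i < s j)%N) -> s = 1%g.
Proof.
have le_s (t : 'S_k) : (forall i j : 'I_k, (i < j)%N -> (t i < t j)%N) ->
    forall i : 'I_k, (i <= t i)%N.
  move=> t_incr [m]; elim: m => [|m IHm] lt_mk //=.
  by apply: leq_ltn_trans (IHm (ltnW lt_mk)) _; apply: t_incr => /=.
move=> s_incr; apply/permP=> i; rewrite perm1; apply/val_inj/eqP.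
rewrite eqn_leq le_s // andbT.
have sV_incr (i1 j1 : 'I_k) : (i1 < j1)%N -> (s^-1%g i1 < s^-1%g j1)%N.
  move=> lt_ij; rewrite ltnNge leq_eqVlt; apply/negP => /orP[/eqP/ord_inj/perm_inj eji|/s_incr].
    by rewrite eji ltnn in lt_ij.
  by rewrite !permKV ltnNge ltnW.
by have := le_s _ sV_incr (s i); rewrite permK.
Qed.

(** Factoring an injection as a permutation followed by an increasing map is unique; with
    [injective_basis_incr] this lets the pairs (a, s) index all injections from ['I_k] to ['I_n]. *)
Lemma basis_incr_perm_inj a b (s t : 'S_k) :
  (forall i, basis_incr a (s i) = basis_incr b (t i)) -> a = b /\ s = t.
Proof.
move=> eq_st; have u1 : (t^-1 * s)%g = 1%g.
  apply: perm_incr_id => i j lt_ij; rewrite -(basis_incr_mono a) !permM !eq_st.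
  by rewrite !permKV basis_incr_mono.
have eq_s : s = t by rewrite -[s]mul1g -(mulgV t) -mulgA u1 mulg1.
split=> //; apply/enum_val_inj/val_inj/ffunP => i.
by have := eq_st (t^-1%g i); rewrite eq_s permKV.
Qed.

Lemma injective_basis_incr f : injective f ->
  exists a, exists s : 'S_k, forall i, f i = basis_incr a (s i).
Proof.
move=> f_inj; case: (@rank_perm k (fun i j => (f i < f j)%N)).
- by move=> i; rewrite ltnn.
- by move=> j i l; apply: ltn_trans.
- by move=> i j; rewrite -(inj_eq f_inj) -val_eqE neq_ltn.
move=> s sP; have [|a aP] := @basis_incr_ex (fun i => f (s^-1%g i)).
  by move=> i j lt_ij; rewrite -sP !permKV.
by exists a, s => i; rewrite aP permK.
Qed.

Definition iset a : {set 'I_n} := [set basis_incr a i | i : 'I_k]%SET.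

Lemma card_iset a : #|iset a| = k.
Proof. by rewrite card_imset ?card_ord //; apply: basis_incr_inj. Qed.

Lemma iset_ex (I : {set 'I_n}) : #|I| = k -> exists a, iset a = I.
Proof.
move=> cardI; pose f (i : 'I_k) := enum_val (cast_ord (esym cardI) i).
have [|a [s sP]] := @injective_basis_incr f.
  by move=> i j /enum_val_inj/cast_ord_inj.
exists a; apply/eqP; rewrite eqEcard card_iset cardI leqnn andbT.
apply/fintype.subsetP => x /imsetP[i _ ->].
by rewrite -(permKV s i) -sP enum_valP.
Qed.

Lemma iset_inj : injective iset.
Proof.
move=> a b eq_ab.
have b_in i : exists j, basis_incr a j == basis_incr b i.
  have : basis_incr b i \in iset a by rewrite eq_ab; apply: imset_f.
  by case/imsetP=> j _ ->; exists j; rewrite eqxx.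
pose t i := xchoose (b_in i); have tP i : basis_incr a (t i) = basis_incr b i.
  exact/eqP/(xchooseP (b_in i)).
have t_inj : injective t.
  by move=> i j eij; apply: (@basis_incr_inj b); rewrite -!tP eij.
have [] // := @basis_incr_perm_inj a b (perm t_inj) 1%g.
by move=> i; rewrite permE perm1 tP.
Qed.

Lemma big_iset (R : Type) (idx : R) (op : Monoid.com_law idx) a (F : 'I_n -> R) :
  \big[op/idx]_(i < k) F (basis_incr a i) = \big[op/idx]_(x in iset a) F x.
Proof. by rewrite big_imset //= => i j _ _; apply: basis_incr_inj. Qed.

End IncreasingMaps.

(** * Exterior powers of matrices; triangular matrices *)

Section ExteriorPowers.

Variable F : fieldType.

(** Expand over all maps f from ['I_k] to ['I_n]. The non-injective ones repeat a row of [B] and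
    drop out; an injective one is a subset a with a permutation s, and summing over s rebuilds the
    minor of [A]. *)
Lemma Cauchy_Binet (k n : nat) (A : 'M[F]_(k, n)) (B : 'M[F]_(n, k)) :
  \det (A *m B) = \sum_(a < ext_dim k n)
    \det (colsub (basis_incr a) A) * \det (rowsub (basis_incr a) B).
Proof.
pose G (f : {ffun 'I_k -> 'I_n}) := (\prod_i A i (f i)) * \det (rowsub f B).
transitivity (\sum_f G f).
  rewrite /G; under [RHS]eq_bigr => f _ do rewrite mulr_sumr.
  rewrite exchange_big /=; apply: eq_bigr => s _.
  under eq_bigr => i _ do rewrite mxE.
  rewrite bigA_distr_bigA mulr_sumr /=; apply: eq_bigr => f _.
  rewrite mulrCA -big_split /=; congr (_ * _); apply: eq_bigr => i _.
  by rewrite mxE.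
pose h (p : 'I_(ext_dim k n) * 'S_k) : {ffun 'I_k -> 'I_n} :=
  [ffun i => basis_incr p.1 (p.2 i)].
have h_inj : injective h.
  move=> [a s] [b t] /ffunP eq_h.
  by have [|-> ->] // := @basis_incr_perm_inj k n a b s t; move=> i; have := eq_h i; rewrite !ffunE.
have im_h (f : {ffun 'I_k -> 'I_n}) : injectiveb f = (f \in [set h p | p in [set: _]]%SET).
  apply/injectiveP/imsetP => [/injective_basis_incr[a [s fE]]|[[a s] _ ->] i j].
    by exists (a, s); rewrite ?inE //; apply/ffunP => i; rewrite ffunE fE.
  by rewrite !ffunE => /basis_incr_inj/perm_inj.
rewrite (bigID (fun f : {ffun _} => injectiveb f)) /= [X in _ + X]big1 ?addr0; last first.
  move=> f /injectivePn[i [j neq_ij eq_f]].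
  rewrite /G (determinant_alternate neq_ij) ?mulr0 // => l.
  by rewrite !mxE eq_f.
rewrite (eq_bigl _ _ im_h) big_imset /=; last by move=> p q _ _; apply: h_inj.
under eq_bigl do rewrite inE.
rewrite -(pair_bigA _ (fun a s => G (h (a, s)))) /=; apply: eq_bigr => a _.
rewrite mulr_suml; apply: eq_bigr => s _; rewrite /G.
have -> : rowsub (h (a, s)) B = row_perm s (rowsub (basis_incr a) B).
  by apply/matrixP => i j; rewrite !mxE ffunE.
rewrite row_permE det_mulmx det_perm mulrCA mulrA; congr (_ * _ * _).
by apply: eq_bigr => i _; rewrite mxE ffunE.
Qed.

Variables k n : nat.
Implicit Types (A B M : 'M[F]_n) (a b c : 'I_(ext_dim k n)).

Lemma ext_powE A a b :
  ext_pow k A a b = \det (mxsub (basis_incr a) (basis_incr b) A).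
Proof. by rewrite mxE. Qed.

Lemma ext_powM A B : ext_pow k (A *m B) = ext_pow k A *m ext_pow k B.
Proof.
apply/matrixP => a b; rewrite ext_powE mxE mxsub_mul Cauchy_Binet.
apply: eq_bigr => c _; rewrite !ext_powE; congr (_ * _); congr (\det _);
by apply/matrixP => i j; rewrite !mxE.
Qed.

Lemma ext_pow_tr A : ext_pow k A^T = (ext_pow k A)^T.
Proof.
by apply/matrixP => a b; rewrite [RHS]mxE !ext_powE -det_tr trmx_mxsub trmxK.
Qed.

Lemma ext_powZ (x : F) A : ext_pow k (x *: A) = x ^+ k *: ext_pow k A.
Proof.
apply/matrixP => a b; rewrite [RHS]mxE !ext_powE -detZ; congr (\det _).
by apply/matrixP => i j; rewrite !mxE.
Qed.

Lemma ext_pow_neq0 A a b : ext_pow k A a b != 0 ->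
  exists s : 'S_k, forall i, A (basis_incr a i) (basis_incr b (s i)) != 0.
Proof.
rewrite ext_powE => nz_det.
suff /existsP[s /forallP sP] : [exists s : 'S_k, forall i,
  A (basis_incr a i) (basis_incr b (s i)) != 0] by exists s.
apply: contraT => /existsPn no_s.
case/eqP: nz_det; rewrite /determinant big1 // => s _.
have /forallPn[i /negPn/eqP Ai0] := no_s s.
by rewrite (bigD1 i) //= mxE Ai0 mul0r mulr0.
Qed.

Lemma ext_pow_diag (d : 'rV[F]_n) : ext_pow k (diag_mx d) =
  diag_mx (\row_a \prod_(i < k) d 0 (basis_incr a i)).
Proof.
apply/matrixP => a b; rewrite !mxE; case: eqVneq => [->|neq_ab] /=.
  rewrite mulr1n; transitivity (\det (diag_mx (\row_(i < k) d 0 (basis_incr b i)))).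
    congr (\det _).
    by apply/matrixP => i j; rewrite !mxE (inj_eq (@basis_incr_inj k n b)).
  by rewrite det_diag; apply: eq_bigr => i _; rewrite mxE.
rewrite mulr0n; apply: contraNeq neq_ab; rewrite -ext_powE => /ext_pow_neq0[s sP].
suff [-> _] : a = b /\ 1%g = s by [].
apply: basis_incr_perm_inj => i; have := sP i; rewrite perm1 mxE; case: (eqVneq (basis_incr a i)) => //= _.
by rewrite mulr0n eqxx.
Qed.

Lemma ext_pow1 : ext_pow k (1%:M : 'M[F]_n) = 1%:M.
Proof.
rewrite -diag_const_mx ext_pow_diag -diag_const_mx; congr diag_mx.
by apply/rowP => a; rewrite !mxE big1 // => i _; rewrite mxE.
Qed.

Lemma ext_pow_unit A : A \in unitmx -> ext_pow k A \in unitmx.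
Proof.
move=> uA; have /mulmx1_unit[//] : ext_pow k A *m ext_pow k (invmx A) = 1%:M.
by rewrite -ext_powM mulmxV // ext_pow1.
Qed.

Lemma unitmx_row_neq0 (m : nat) (A : 'M[F]_m) i : A \in unitmx -> exists j, A i j != 0.
Proof.
move=> uA; apply/existsP; apply: contraT => /existsPn A0.
have /matrixP/(_ i i)/eqP := mulmxV uA; rewrite !mxE eqxx big1 ?(eq_sym 0) ?oner_eq0 //.
by move=> j _; have /negPn/eqP-> := A0 j; rewrite mul0r.
Qed.

Lemma unitmx_col_neq0 (m : nat) (A : 'M[F]_m) j : A \in unitmx -> exists i, A i j != 0.
Proof.
by rewrite -unitmx_tr => uA; have [l] := unitmx_row_neq0 j uA; rewrite mxE; exists l.
Qed.

Definition upper_mx (m : nat) (A : 'M[F]_m) := forall i j : 'I_m, (j < i)%N -> A i j = 0.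

Lemma upper_mx_trig m (A : 'M[F]_m) : upper_mx A -> is_trig_mx A^T.
Proof. by move=> upA; apply/is_trig_mxP => i j lt_ij; rewrite mxE upA. Qed.

Lemma det_upper m (A : 'M[F]_m) : upper_mx A -> \det A = \prod_i A i i.
Proof.
move=> upA; rewrite -det_tr det_trig; last exact: upper_mx_trig.
by apply: eq_bigr => i _; rewrite mxE.
Qed.

Lemma upper_mxM m (A B : 'M[F]_m) : upper_mx A -> upper_mx B -> upper_mx (A *m B).
Proof.
move=> upA upB i j lt_ji; rewrite mxE big1 // => l _.
case: (ltnP l i) => [/upA->|le_il]; first by rewrite mul0r.
by rewrite upB ?mulr0 //; apply: leq_trans lt_ji le_il.
Qed.

Lemma upper_mxZ m x (A : 'M[F]_m) : upper_mx A -> upper_mx (x *: A).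
Proof. by move=> upA i j lt_ji; rewrite mxE upA // mulr0. Qed.

Lemma upper_mx_diag m (d : 'rV[F]_m) : upper_mx (diag_mx d).
Proof. by move=> i j lt_ji; rewrite mxE -val_eqE gtn_eqF. Qed.

Lemma upper_unit_diag m (A : 'M[F]_m) i : upper_mx A -> A \in unitmx -> A i i != 0.
Proof.
move=> upA; rewrite unitmxE unitfE det_upper // => /prodf_neq0; exact.
Qed.

Lemma upper_unitP m (A : 'M[F]_m) : upper_mx A -> (forall i, A i i != 0) -> A \in unitmx.
Proof. by move=> upA nzA; rewrite unitmxE unitfE det_upper //; apply/prodf_neq0. Qed.

Lemma upper_mx_inv m (A : 'M[F]_m) : upper_mx A -> A \in unitmx -> upper_mx (invmx A).
Proof.
move=> upA uA i j; case: j => j; elim/ltn_ind: j => j IHj lt_jm /= lt_ji.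
have /matrixP/(_ i (Ordinal lt_jm)) := mulVmx uA.
rewrite !mxE -val_eqE /= gtn_eqF // (bigD1 (Ordinal lt_jm)) //= big1 ?addr0.
  move/eqP; rewrite mulf_eq0 => /orP[/eqP//|].
  by rewrite (negPf (upper_unit_diag _ upA uA)).
move=> l neq_lj; case: (ltngtP l j) => [lt_lj|lt_jl|eq_lj].
- by case: l lt_lj {neq_lj} => l lt_lm lt_lj; rewrite IHj ?mul0r //; apply: ltn_trans lt_ji.
- by rewrite upA ?mulr0.
- by case/eqP: neq_lj; apply: val_inj.
Qed.

Definition isum a := (\sum_(i < k) basis_incr a i)%N.

(* [isum] grades the k-subsets so that exterior powers of triangular matrices
   are triangular. *)
Lemma ext_pow_upper A a b : upper_mx A -> ext_pow k A a b != 0 ->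
  a = b \/ (isum a < isum b)%N.
Proof.
move=> upA /ext_pow_neq0[s sP].
have le_s i : (basis_incr a i <= basis_incr b (s i))%N.
  by rewrite leqNgt; apply: contra (sP i) => /upA->.
have sum_b : isum b = (\sum_(i < k) basis_incr b (s i))%N.
  by rewrite /isum (reindex_inj (@perm_inj _ s)).
case: (ltnP (isum a) (isum b)) => [|le_ba]; [by right | left].
suff [-> _] : a = b /\ 1%g = s by [].
apply: basis_incr_perm_inj => i; rewrite perm1; apply/val_inj/eqP; rewrite eqn_leq le_s /= leqNgt.
apply: contraL le_ba => lt_i; rewrite -ltnNge sum_b /isum.
rewrite (bigD1 i) //= [in X in (_ < X)%N](bigD1 i) //= -addSn leq_add //.
by apply: leq_sum.
Qed.

Lemma ext_pow_upper_diag A a : upper_mx A ->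
  ext_pow k A a a = \prod_(i < k) A (basis_incr a i) (basis_incr a i).
Proof.
move=> upA; rewrite ext_powE det_upper; first by apply: eq_bigr => i _; rewrite mxE.
by move=> i j lt_ji; rewrite mxE upA ?basis_incr_mono.
Qed.

End ExteriorPowers.

(** * Leading terms: restriction to the subsets of minimal weight *)

Section MinimalWeight.

Variables (F : fieldType) (k n : nat).
Implicit Types (A M l : 'M[F]_n) (a b : 'I_(ext_dim k n)) (be : 'I_n -> nat).

Definition weight be a := (\sum_(i < k) be (basis_incr a i))%N.

Definition min_weight be a := [forall b, weight be a <= weight be b]%N.

Definition min_proj be : 'M[F]_(ext_dim k n) := diag_mx (\row_a (min_weight be a)%:R).

(* The leading term of [ext_pow k (T_s A T_s)], [T_s = diag (s ^ be)], as [s] tends to 0. *)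
Definition lim_ext be A := min_proj be *m ext_pow k A *m min_proj be.

Lemma min_projMl be (M : 'M[F]_(ext_dim k n)) a b :
  (min_proj be *m M) a b = (min_weight be a)%:R * M a b.
Proof. by rewrite mul_diag_mx !mxE. Qed.

Lemma min_projMr be (M : 'M[F]_(ext_dim k n)) a b :
  (M *m min_proj be) a b = M a b * (min_weight be b)%:R.
Proof. by rewrite mul_mx_diag !mxE. Qed.

Lemma lim_extE be A a b :
  lim_ext be A a b = if min_weight be a && min_weight be b then ext_pow k A a b else 0.
Proof.
rewrite min_projMr min_projMl.
by case: min_weight; case: min_weight; rewrite ?mulr1 ?mul1r ?mulr0 ?mul0r.
Qed.

Lemma weight_perm be a (s : 'S_k) :
  weight be a = (\sum_(i < k) be (basis_incr a (s i)))%N.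
Proof. by rewrite /weight (reindex_inj (@perm_inj _ s)). Qed.

Lemma weight_ext_pow be be' M a b :
  (forall i j, M i j != 0 -> be i = be' j) -> ext_pow k M a b != 0 ->
  weight be a = weight be' b.
Proof.
move=> Mbe /ext_pow_neq0[s sP]; rewrite (weight_perm be' b s).
by apply: eq_bigr => i _; apply: Mbe.
Qed.

(** [ext_pow k M] only joins subsets of equal weight and, being invertible, has a nonzero entry in
    every row and column; so both weights have the same minimum, attained on corresponding
    subsets. *)
Lemma min_proj_comm be be' M : M \in unitmx ->
  (forall i j, M i j != 0 -> be i = be' j) ->
  min_proj be *m ext_pow k M = ext_pow k M *m min_proj be'.
Proof.
move=> uM Mbe; apply/matrixP => a b; rewrite min_projMl min_projMr mulrC.
have [->|nzM] := eqVneq (ext_pow k M a b) 0; first by rewrite !mul0r.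
congr (_ * _%:R); have wab := weight_ext_pow Mbe nzM.
congr nat_of_bool; apply/forallP/forallP => min_w c.
  have [d nzd] := unitmx_col_neq0 c (ext_pow_unit k uM).
  by rewrite -wab -(weight_ext_pow Mbe nzd).
have [d nzd] := unitmx_row_neq0 c (ext_pow_unit k uM).
by rewrite wab (weight_ext_pow Mbe nzd).
Qed.

Lemma lim_ext_cong be be' M A : M \in unitmx ->
  (forall i j, M i j != 0 -> be i = be' j) ->
  (ext_pow k M)^T *m lim_ext be A *m ext_pow k M = lim_ext be' (M^T *m A *m M).
Proof.
move=> uM Mbe; rewrite /lim_ext !ext_powM ext_pow_tr.
have EM := min_proj_comm uM Mbe.
have EMT : (ext_pow k M)^T *m min_proj be = min_proj be' *m (ext_pow k M)^T.
  have := congr1 trmx EM; rewrite !trmx_mul /min_proj !tr_diag_mx; exact.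
by rewrite !mulmxA EMT -!mulmxA EM.
Qed.

Definition block_part be l := \matrix_(i, j) if be i == be j then l i j else 0.

(** A Leibniz term using an entry of [l] between different levels would lead from a subset of
    minimal weight to one of strictly smaller weight. *)
Lemma min_proj_block be l : (forall i j, l i j != 0 -> (be j <= be i)%N) ->
  min_proj be *m ext_pow k l = min_proj be *m ext_pow k (block_part be l).
Proof.
move=> lbe; apply/matrixP => a b; rewrite !min_projMl.
case: (boolP (min_weight be a)) => [min_a|_]; last by rewrite !mul0r.
congr (_ * _); rewrite !ext_powE; apply: eq_bigr => s _; congr (_ * _).
case: (boolP [forall i, be (basis_incr a i) == be (basis_incr b (s i))]).
  by move=> /forallP all_eq; apply: eq_bigr => i _; rewrite !mxE all_eq.
case/forallPn => i0 neq_i0; rewrite [RHS](bigD1 i0) //= !mxE (negPf neq_i0) mul0r.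
apply/eqP; apply: contraTT (forallP min_a b) => /prodf_neq0 nz_l.
rewrite -ltnNge (weight_perm be b s) /weight.
have le_i i : (be (basis_incr b (s i)) <= be (basis_incr a i))%N.
  by apply: lbe; have := nz_l i isT; rewrite mxE.
rewrite (bigD1 i0) //= [in X in (_ < X)%N](bigD1 i0) //= -addSn leq_add //.
  by rewrite ltn_neqAle eq_sym neq_i0 le_i.
by apply: leq_sum.
Qed.

Lemma lim_ext_block be l A : (forall i j, l i j != 0 -> (be j <= be i)%N) ->
  block_part be l \in unitmx ->
  (ext_pow k l)^T *m lim_ext be A *m ext_pow k l =
  lim_ext be ((block_part be l)^T *m A *m block_part be l).
Proof.
move=> lbe ul0; have El := min_proj_block lbe.
have ElT : (ext_pow k l)^T *m min_proj be = (ext_pow k (block_part be l))^T *m min_proj be.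
  have := congr1 trmx El; rewrite !trmx_mul /min_proj !tr_diag_mx; exact.
rewrite -(@lim_ext_cong be be) //; last first.
  by move=> i j; rewrite mxE; case: (be i =P be j) => // _; rewrite eqxx.
by rewrite /lim_ext !mulmxA ElT -!mulmxA El.
Qed.

Lemma ex_min_weight be : (k <= n)%N -> exists a, min_weight be a.
Proof.
move=> le_kn; have [a0 _] : exists a : 'I_(ext_dim k n), basis_incr a =1 widen_ord le_kn.
  exact: basis_incr_ex.
have [a _ min_a] := @arg_minnP _ a0 xpredT (weight be) isT.
by exists a; apply/forallP => b; apply: min_a.
Qed.

Lemma lim_ext_neq0 be A : (k <= n)%N -> A \in unitmx ->
  (forall i j, A i j != 0 -> be i = be j) -> lim_ext be A != 0.
Proof.
move=> le_kn uA Abe; have [a min_a] := ex_min_weight be le_kn.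
have [b nzb] := unitmx_row_neq0 a (ext_pow_unit k uA).
have min_b : min_weight be b.
  by apply/forallP => c; rewrite -(weight_ext_pow Abe nzb) (forallP min_a).
by apply: contraNneq nzb => /matrixP/(_ a b); rewrite lim_extE min_a min_b /= => ->; rewrite mxE.
Qed.

Lemma lim_ext_tr be A : (lim_ext be A)^T = lim_ext be A^T.
Proof.
by rewrite /lim_ext !trmx_mul ext_pow_tr /min_proj !tr_diag_mx mulmxA.
Qed.

End MinimalWeight.

(** * Points as families of lines, congruences and Borel orbits *)

Section Points.

Variables (F : fieldType) (n : nat).
Implicit Types (g h : 'M[F]_n) (x : quadric_point F n).
Local Notation family := (forall k : 'I_n.-1, 'M[F]_(ext_dim k.+1 n)).
Implicit Types (u v : family).

Definition point_of v : quadric_point F n := fun k => <[v k]>%VS.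

Definition cong_fam h v : family :=
  fun k => (ext_pow k.+1 h)^T *m v k *m ext_pow k.+1 h.

Lemma eq_point x y : (forall k, x k = y k) -> x = y.
Proof. exact: functional_extensionality_dep. Qed.

Lemma multipointP x : is_multipoint x -> exists v, x = point_of v /\ forall k, v k != 0.
Proof.
move=> x1; exists (fun k => vpick (x k)); split.
  apply: eq_point => k; apply/esym/eqP; rewrite eqEdim x1 dim_vline vpick0 -dimv_eq0 x1.
  by rewrite -memvE memv_pick.
by move=> k; rewrite vpick0 -dimv_eq0 x1.
Qed.

Lemma point_of_multipoint v : (forall k, v k != 0) -> is_multipoint (point_of v).
Proof. by move=> nzv k; rewrite dim_vline nzv. Qed.

Lemma vline_eqP (V : vectType F) (a b : V) : a != 0 -> <[a]>%VS = <[b]>%VS ->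
  exists2 c, c != 0 & a = c *: b.
Proof.
move=> nza eq_ab; have /vlineP[c def_a] : a \in <[b]>%VS by rewrite -eq_ab memv_line.
by exists c => //; apply: contraNneq nza => c0; rewrite def_a c0 scale0r.
Qed.

Lemma vline_scale (V : vectType F) (a : V) c : c != 0 -> <[c *: a]>%VS = <[a]>%VS.
Proof.
move=> nzc; apply/eqP; rewrite eqEsubv -!memvE; apply/andP; split.
  by apply/vlineP; exists c.
by apply/vlineP; exists c^-1; rewrite scalerA mulVf // scale1r.
Qed.

Lemma point_of_scale (c : 'I_n.-1 -> F) v : (forall k, c k != 0) ->
  point_of (fun k => c k *: v k) = point_of v.
Proof. by move=> nzc; apply: eq_point => k; apply: vline_scale. Qed.

Lemma quadric_act_point g v :
  quadric_act g (point_of v) = point_of (cong_fam (invmx g) v).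
Proof.
apply: eq_point => k; rewrite /quadric_act /point_of limg_line; congr <[_]>%VS.
rewrite /cong_fam -ext_pow_tr trmx_inv.
exact: (lfunE (mulmxr (ext_pow k.+1 (invmx g)) \o mulmx (ext_pow k.+1 (invmx g^T)))).
Qed.

Lemma cong_famM g h v : cong_fam g (cong_fam h v) = cong_fam (h *m g) v.
Proof.
apply: functional_extensionality_dep => k.
by rewrite /cong_fam ext_powM trmx_mul !mulmxA.
Qed.

Lemma cong_fam1 v : cong_fam 1%:M v = v.
Proof.
by apply: functional_extensionality_dep => k; rewrite /cong_fam ext_pow1 trmx1 mul1mx mulmx1.
Qed.

Lemma cong_fam_scale h (c : 'I_n.-1 -> F) v :
  cong_fam h (fun k => c k *: v k) = (fun k => c k *: cong_fam h v k).
Proof.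
by apply: functional_extensionality_dep => k; rewrite /cong_fam -scalemxAr -scalemxAl.
Qed.

Lemma cong_fam_point h u v : point_of u = point_of v -> (forall k, u k != 0) ->
  point_of (cong_fam h u) = point_of (cong_fam h v).
Proof.
move=> eq_uv nzu; apply: eq_point => k; rewrite /point_of /cong_fam.
have [c nzc ->] := vline_eqP (nzu k) (congr1 (fun x : quadric_point F n => x k) eq_uv).
by rewrite -scalemxAr -scalemxAl vline_scale.
Qed.

Definition lim_fam (be : 'I_n -> nat) (A : 'M[F]_n) : family :=
  fun k => lim_ext k.+1 be A.

Lemma ltn_pred_ord (k : 'I_n.-1) : (k.+1 < n)%N.
Proof. by case: k => k /=; rewrite ltn_predRL. Qed.

Lemma lim_fam_neq0 be A k : A \in unitmx ->
  (forall i j, A i j != 0 -> be i = be j) -> lim_fam be A k != 0.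
Proof. by apply: lim_ext_neq0; apply: ltnW; apply: ltn_pred_ord. Qed.

End Points.

Section Orbits.

Variables (F : closedFieldType) (n : nat).
Implicit Types (g h : 'M[F]_n).
Local Notation family := (forall k : 'I_n.-1, 'M[F]_(ext_dim k.+1 n)).
Implicit Types (u v : family).

Lemma ex_root (m : nat) (c : F) : (0 < m)%N -> exists z : F, z ^+ m = c.
Proof.
case: m => // m _; have [z zP] := @solve_monicpoly F m.+1 (fun i => if i == 0%N then c else 0) isT.
exists z; rewrite zP big_ord_recl /= expr0 mulr1 big1 ?addr0 // => i _.
by rewrite mul0r.
Qed.

(** Scalars fix every line, so [h] may be rescaled to determinant 1 by an [n]-th root of the inverse
    of its determinant; the acting element is then the inverse of the rescaled [h]. *)
Lemma borel_orbitP v y : borel_orbit (point_of v) y <->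
  exists h, [/\ upper_mx h, h \in unitmx & y = point_of (cong_fam h v)].
Proof.
split=> [[g [detg upg] ->]|[h [uph uh ->]]].
  have ug : g \in unitmx by rewrite unitmxE detg unitr1.
  exists (invmx g); split; rewrite ?unitmx_inv ?quadric_act_point //.
  exact: upper_mx_inv.
case: n v h uph uh => [|m] v h uph uh.
  exists 1%:M; first by split=> [|[]//]; rewrite det1.
  by apply: eq_point; case.
have [z zP] := ex_root (\det h)^-1 (ltn0Sn m).
have nzh : \det h != 0 by rewrite -unitfE -unitmxE.
have nzz : z != 0.
  by apply: contraNneq nzh => z0; rewrite -invr_eq0 -zP z0 expr0n.
have uzh : z *: h \in unitmx by rewrite unitmxE detZ zP mulVf // unitr1.
exists (invmx (z *: h)).
  split; first by rewrite det_inv detZ zP mulVf // invr1.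
  by apply: upper_mx_inv => //; apply: upper_mxZ.
rewrite quadric_act_point invmxK; apply: eq_point => k; rewrite /point_of /cong_fam.
rewrite ext_powZ -scalemxAr [(_ *: _)^T]linearZ -!scalemxAl scalerA vline_scale //.
by rewrite mulf_neq0 ?expf_neq0.
Qed.

Lemma borel_orbit_eq u v : (forall k, u k != 0) -> (forall k, v k != 0) ->
  borel_orbit (point_of u) = borel_orbit (point_of v) <->
  exists h, [/\ upper_mx h, h \in unitmx & point_of u = point_of (cong_fam h v)].
Proof.
move=> nzu nzv; split=> [eq_uv|[h [uph uh eq_u]]].
  have : borel_orbit (point_of u) (point_of u).
    apply/borel_orbitP; exists 1%:M; rewrite unitmx1 cong_fam1; split=> //.
    by move=> i j lt_ji; rewrite mxE -val_eqE gtn_eqF.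
  by rewrite eq_uv => /borel_orbitP.
rewrite predeqE => y; split=> /borel_orbitP[g [upg ug ->]]; apply/borel_orbitP.
  exists (h *m g); rewrite unitmx_mul uh ug; split=> //; first exact: upper_mxM.
  by rewrite -cong_famM (cong_fam_point _ eq_u).
exists (invmx h *m g); rewrite unitmx_mul unitmx_inv uh ug; split=> //.
  by apply: upper_mxM => //; apply: upper_mx_inv.
by rewrite (cong_fam_point _ eq_u) // cong_famM mulmxA mulmxV // mul1mx.
Qed.

End Orbits.

(** * Bruhat decomposition and symmetric Gaussian elimination *)

Section Elimination.

Variables (F : fieldType) (n : nat).
Implicit Types (A B M b : 'M[F]_n) (i j p q : 'I_n) (r : 'I_n -> F).

Definition elim_mx i r : 'M[F]_n := \matrix_(p, q) ((p == q)%:R - r p * (q == i)%:R).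

Lemma elim_mxM i r M p q : (elim_mx i r *m M) p q = M p q - r p * M i q.
Proof.
rewrite mxE; under eq_bigr => l _ do rewrite mxE mulrBl -mulrA.
rewrite sumrB; congr (_ - _).
  by rewrite (bigD1 p) //= eqxx mul1r big1 ?addr0 // => l /negPf; rewrite eq_sym => ->; rewrite mul0r.
by rewrite (bigD1 i) //= eqxx mul1r big1 ?addr0 // => l /negPf ->; rewrite mul0r mulr0.
Qed.

Lemma mul_elim_mxT i r M p q : (M *m (elim_mx i r)^T) p q = M p q - M p i * r q.
Proof.
by rewrite -[M *m _]trmxK [LHS]mxE trmx_mul trmxK elim_mxM !mxE mulrC.
Qed.

Lemma elim_mxT_upper i r : (forall p, (p <= i)%N -> r p = 0) -> upper_mx (elim_mx i r)^T.
Proof.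
move=> r0 p q lt_qp; rewrite !mxE -val_eqE ltn_eqF // sub0r.
by case: eqVneq => [eq_pi|_]; rewrite ?mulr0 ?oppr0 // r0 ?mul0r ?oppr0 // -eq_pi ltnW.
Qed.

Lemma elim_mxT_unit i r : (forall p, (p <= i)%N -> r p = 0) -> (elim_mx i r)^T \in unitmx.
Proof.
move=> r0; apply: upper_unitP; first exact: elim_mxT_upper.
move=> p; rewrite !mxE eqxx; case: (eqVneq p i) => [->|_]; last by rewrite mulr0 subr0 oner_eq0.
by rewrite r0 // mul0r subr0 oner_eq0.
Qed.

(** Columns are treated from left to right. The pivot of a column is its topmost nonzero entry, so
    that the rows below are cleared by lower triangular operations and the columns to the right by
    upper triangular ones; a permutation matrix times a diagonal one remains. *)
Lemma Bruhat h : h \in unitmx -> exists l b : 'M[F]_n, exists w : 'S_n,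
  [/\ upper_mx l^T, l \in unitmx, upper_mx b, b \in unitmx & h = l *m perm_mx w *m b].
Proof.
move=> uh.
pose pivot M (f : 'I_n -> 'I_n) j :=
  [/\ M (f j) j != 0, forall q, q != j -> M (f j) q = 0 & forall p, p != f j -> M p j = 0].
have [l [b [f [upl ul upb ub fP]]]] : exists l b : 'M[F]_n, exists f : 'I_n -> 'I_n,
    [/\ upper_mx l^T, l \in unitmx, upper_mx b, b \in unitmx &
     forall j : 'I_n, (j < n)%N -> pivot (l *m h *m b) f j].
  suff H m : (m <= n)%N -> exists l b : 'M[F]_n, exists f : 'I_n -> 'I_n,
    [/\ upper_mx l^T, l \in unitmx, upper_mx b, b \in unitmx &
     forall j : 'I_n, (j < m)%N -> pivot (l *m h *m b) f j] by apply: H.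
  elim: m => [|m IHm] lt_mn.
    exists 1%:M, 1%:M, id; rewrite trmx1 unitmx1; split=> //;
    by move=> i j lt_ji; rewrite mxE -val_eqE gtn_eqF.
  have [l [b [f [upl ul upb ub fP]]]] := IHm (ltnW lt_mn).
  set M := l *m h *m b in fP; pose m' := Ordinal lt_mn.
  have uM : M \in unitmx by rewrite !unitmx_mul ul uh ub.
  have [i0 nz_i0] := unitmx_col_neq0 m' uM.
  have [i nz_i min_i] := @arg_minnP _ i0 (fun i => M i m' != 0) (@nat_of_ord n) nz_i0.
  (* The rows of earlier pivots vanish in column [m'], so row [i] is a new one and is zero in the
     columns already treated; this keeps the earlier pivots intact. *)
  have Mi_done j : (j < m)%N -> M i j = 0.
    move=> lt_jm; have [_ row0 col0] := fP j lt_jm; apply: col0.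
    by apply: contraNneq nz_i => ->; rewrite row0 // -val_eqE /= gtn_eqF.
  pose c p := if p == i then 0 else M p m' / M i m'.
  have c0 p : (p <= i)%N -> c p = 0.
    rewrite /c; case: eqVneq => // neq_pi le_pi.
    have -> : M p m' = 0; last by rewrite mul0r.
    apply/eqP; apply: contraNT neq_pi => /min_i le_ip.
    by rewrite -val_eqE /= eqn_leq le_pi.
  have c_done j : (j < m)%N -> c (f j) = 0.
    move=> lt_jm; have [_ row0 _] := fP j lt_jm; rewrite /c row0 ?mul0r ?if_same //.
    by rewrite -val_eqE /= gtn_eqF.
  pose d q := if q == m' then 0 else M i q / M i m'.
  have d0 q : (q <= m')%N -> d q = 0.
    rewrite /d; case: eqVneq => // neq_qm le_qm.
    by rewrite Mi_done ?mul0r // ltn_neqAle le_qm andbT.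
  exists (elim_mx i c *m l), (b *m (elim_mx m' d)^T), (fun j => if j == m' then i else f j).
  split.
  - by rewrite trmx_mul; apply: upper_mxM => //; apply: elim_mxT_upper.
  - by rewrite unitmx_mul ul andbT -unitmx_tr elim_mxT_unit.
  - by apply: upper_mxM => //; apply: elim_mxT_upper.
  - by rewrite unitmx_mul ub elim_mxT_unit.
  have M'E p q : (elim_mx i c *m l *m h *m (b *m (elim_mx m' d)^T)) p q =
      M p q - c p * M i q - (M p m' - c p * M i m') * d q.
    by rewrite !mulmxA mul_elim_mxT -!(mulmxA (elim_mx i c)) !elim_mxM.
  move=> j lt_j; rewrite /pivot; have [->|neq_jm] := eqVneq j m'.
    split=> [|q neq_q|p neq_p]; rewrite M'E.
    - by rewrite /c /d !eqxx !mul0r !subr0 mulr0 subr0.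
    - by rewrite /c /d eqxx (negPf neq_q) !mul0r !subr0 mulrCA mulfV // mulr1 subrr.
    - by rewrite /c /d eqxx (negPf neq_p) mulr0 subr0 mulfVK // subrr.
  have {neq_jm}lt_jm : (j < m)%N by rewrite ltn_neqAle -ltnS lt_j andbT.
  have neq_m'j : m' != j by rewrite -val_eqE /= gtn_eqF.
  have [nz row0 col0] := fP j lt_jm; split=> [|q neq_q|p neq_p]; rewrite M'E.
  - by rewrite c_done // [M _ m']row0 // !mul0r !subr0 mul0r subr0.
  - by rewrite c_done // [M _ m']row0 // [M _ q]row0 // !mul0r !subr0 mul0r subr0.
  - by rewrite (d0 j) ?mulr0 ?subr0 ?Mi_done ?mulr0 ?subr0 ?col0 //= ltnW.
have [M defM] : exists M, M = l *m h *m b by exists (l *m h *m b).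
rewrite -defM in fP.
have f_inj : injective f.
  move=> j j' eq_f; have [_ row0 _] := fP j (ltn_ord j); have [nz _ _] := fP j' (ltn_ord j').
  by apply/eqP/negPn/negP => neq_jj; case/eqP: nz; rewrite -eq_f row0 // eq_sym.
pose d := \row_j M (f j) j.
have ud : diag_mx d \in unitmx.
  apply: upper_unitP => [|j]; first exact: upper_mx_diag.
  by have [nz _ _] := fP j (ltn_ord j); rewrite !mxE eqxx mulr1n.
have ME : M = perm_mx (perm f_inj)^-1%g *m diag_mx d.
  apply/matrixP => p q; rewrite mul_mx_diag !mxE.
  have -> : ((perm f_inj)^-1%g p == q) = (p == f q).
    by rewrite -(inj_eq (@perm_inj _ (perm f_inj))) permKV permE.
  have [_ _ col0] := fP q (ltn_ord q); case: eqVneq => [->|/col0->]; first by rewrite mul1r.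
  by rewrite mul0r.
exists (invmx l), (diag_mx d *m invmx b), (perm f_inj)^-1%g; split.
- by rewrite trmx_inv; apply: upper_mx_inv; rewrite ?unitmx_tr.
- by rewrite unitmx_inv.
- by apply: upper_mxM; [apply: upper_mx_diag | apply: upper_mx_inv].
- by rewrite unitmx_mul ud unitmx_inv.
by rewrite !mulmxA -(mulmxA _ (perm_mx _)) -ME defM !mulmxA mulVmx // mul1mx -mulmxA mulmxV // mulmx1.
Qed.

Lemma mulmx_neq0 (m1 m2 m3 : nat) (A : 'M[F]_(m1, m2)) (B : 'M[F]_(m2, m3))
    (i : 'I_m1) (j : 'I_m3) :
  (A *m B) i j != 0 -> exists2 l, A i l != 0 & B l j != 0.
Proof.
move=> nz; have [l] : exists l, A i l * B l j != 0.
  apply/existsP; apply: contraT => /existsPn all0; case/eqP: nz.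
  by rewrite mxE big1 // => l _; have /negPn/eqP := all0 l.
by rewrite mulf_eq0 negb_or => /andP[nzA nzB]; exists l.
Qed.

Definition blockwise (be : 'I_n -> nat) A := forall i j, A i j != 0 -> be i = be j.

Lemma blockwiseM be A B : blockwise be A -> blockwise be B -> blockwise be (A *m B).
Proof.
by move=> bA bB i j /mulmx_neq0[l /bA-> /bB].
Qed.

Lemma blockwise_tr be A : blockwise be A -> blockwise be A^T.
Proof. by move=> bA i j; rewrite mxE => /bA. Qed.

Lemma blockwise_diag be (d : 'rV[F]_n) : blockwise be (diag_mx d).
Proof. by move=> i j; rewrite mxE; case: (eqVneq i j) => [->//|_]; rewrite mulr0n eqxx. Qed.

Lemma blockwise_elim be i r : (forall p, r p != 0 -> be p = be i) -> blockwise be (elim_mx i r).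
Proof.
move=> br p q; rewrite mxE; case: (eqVneq p q) => [->//|_]; case: (eqVneq q i) => [->|_].
  by rewrite sub0r oppr_eq0 mulr1 => /br.
by rewrite mulr0 subr0 eqxx.
Qed.

(** For symmetric [A] this makes the indices in [S] orthogonal to the others, so elimination can
    continue on the complement without disturbing [S]. *)
Definition monomial_on (S : {set 'I_n}) A := forall p, p \in S ->
  exists q, [/\ q \in S, A p q != 0 & forall q', q' != q -> A p q' = 0].

Lemma elim_congE i r A p q : (elim_mx i r *m A *m (elim_mx i r)^T) p q =
  A p q - r p * A i q - (A p i - r p * A i i) * r q.
Proof. by rewrite mul_elim_mxT !elim_mxM. Qed.

Lemma congr_sym A b : A^T = A -> (b *m A *m b^T)^T = b *m A *m b^T.
Proof. by move=> sA; rewrite !trmx_mul trmxK sA mulmxA. Qed.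

(** Let [j] be the first index outside [S] and [i] the first one with [A j i] nonzero; then
    [j <= i]. Row [i] clears the rest of column [j]. If [i = j], this adds [j] to [S]; otherwise row
    [j] then clears column [i] and [S] gains the 2-cycle of [i] and [j]. A row is only subtracted
    from rows of larger index and the same level, so the congruence stays triangular and
    blockwise. *)
Lemma sym_elim_step be A (S : {set 'I_n}) : (2%:R : F) != 0 ->
  A^T = A -> A \in unitmx -> blockwise be A -> monomial_on S A -> S != finset.setT ->
  exists b, exists S' : {set 'I_n}, [/\ upper_mx b^T, b \in unitmx, blockwise be b,
    monomial_on S' (b *m A *m b^T) & (#|S| < #|S'|)%N].
Proof.
move=> nz2 sA uA bA mA neqST.
have AC p q : A p q = A q p by rewrite -[in LHS]sA mxE.
have [j0 nS_j0] : exists j0, j0 \notin S.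
  apply/existsP; apply: contraNT neqST => /existsPn all_in.
  by apply/eqP/setP => x; rewrite inE; apply/negPn.
have [j nSj min_j] := @arg_minnP _ j0 (fun j => j \notin S) (@nat_of_ord n) nS_j0.
have [i0 nz_i0] := unitmx_row_neq0 j uA.
have [i nz_i min_i] := @arg_minnP _ i0 (fun i => A j i != 0) (@nat_of_ord n) nz_i0.
have S_nS p q : p \in S -> q \notin S -> A p q = 0.
  move=> Sp nSq; have [q' [Sq' _ all0]] := mA p Sp; apply: all0.
  by apply: contraNneq nSq => ->.
have nSi : i \notin S.
  by apply: contraNN nz_i => Si; rewrite AC S_nS.
have le_ji : (j <= i)%N := min_j i nSi.
have lt_S p : (p < j)%N -> p \in S.
  by apply: contraTT => /min_j; rewrite -leqNgt.
have nz_ij : A i j != 0 by rewrite AC.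
have be_ij : be i = be j by apply: bA.
pose r p := if p == i then 0 else A p j / A i j.
have r0 p : (p <= i)%N -> r p = 0.
  rewrite /r; case: eqVneq => // neq_pi le_pi; rewrite AC.
  have [->|/min_i le_ip] := eqVneq (A j p) 0; first by rewrite mul0r.
  by case/eqP: neq_pi; apply/val_inj/eqP; rewrite eqn_leq le_pi.
have rS p : p \in S -> r p = 0.
  by move=> Sp; rewrite /r S_nS // mul0r if_same.
have rj : r j = 0 by apply: r0.
have ri : r i = 0 by apply: r0.
have b1 : blockwise be (elim_mx i r).
  apply: blockwise_elim => p; rewrite /r; case: (eqVneq p i) => [->//|_] nz_p.
  by rewrite be_ij; apply: bA; apply: contraNneq nz_p => ->; rewrite mul0r.
have u1 : elim_mx i r \in unitmx by rewrite -unitmx_tr elim_mxT_unit.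
have up1 : upper_mx (elim_mx i r)^T by apply: elim_mxT_upper.
pose A1 := elim_mx i r *m A *m (elim_mx i r)^T.
have sA1 : A1^T = A1 by apply: congr_sym.
have A1C p q : A1 p q = A1 q p by rewrite -[in LHS]sA1 mxE.
have A1S p q : p \in S -> A1 p q = A p q.
  by move=> Sp; rewrite elim_congE rS // (S_nS p i) // !mul0r !subr0 mul0r subr0.
have A1j p : p != i -> A1 p j = 0.
  move=> neq_pi; rewrite elim_congE rj mulr0 subr0 /r (negPf neq_pi).
  by rewrite mulfVK // subrr.
have A1ij : A1 i j = A i j by rewrite elim_congE rj ri mul0r mulr0 !subr0.
have [eq_ij|neq_ij] := eqVneq i j.
  exists (elim_mx i r), (j |: S)%SET; split=> //; last first.
    by rewrite cardsU1 nSj.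
  move=> p; rewrite !inE => /orP[/eqP->|Sp].
    exists j; rewrite !inE eqxx -/A1 -[X in A1 X j]eq_ij A1ij; split=> // q' neq_q'.
    by rewrite A1C A1j // eq_ij.
  have [q [Sq nz_q all0]] := mA p Sp; exists q; rewrite !inE Sq orbT -/A1 A1S //.
  by split=> // q' /all0 <-; rewrite A1S.
have A1jj : A1 j j = 0 by rewrite A1j // eq_sym.
(* The entry at [(i, i)] is changed once by the row and once by the column operation, so half of the
   coefficient is used there. *)
pose r' p := if p == j then 0 else A1 p i / A1 j i / (if p == i then 2%:R else 1).
have nz_ji : A1 j i != 0 by rewrite A1C A1ij.
have r'S p : p \in S -> r' p = 0.
  by move=> Sp; rewrite /r' A1S // S_nS // !mul0r if_same.
have r'0 p : (p <= j)%N -> r' p = 0.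
  rewrite leq_eqVlt => /orP[/eqP/val_inj->|/lt_S/r'S//]; by rewrite /r' eqxx.
have bA1 : blockwise be A1 by apply: blockwiseM (blockwiseM b1 bA) (blockwise_tr b1).
have b2 : blockwise be (elim_mx j r').
  apply: blockwise_elim => p; rewrite /r'; case: (eqVneq p j) => [->//|_] nz_p.
  rewrite -be_ij; apply: bA1; apply: contraNneq nz_p => ->; by rewrite !mul0r.
exists (elim_mx j r' *m elim_mx i r), (i |: (j |: S))%SET.
have -> : elim_mx j r' *m elim_mx i r *m A *m (elim_mx j r' *m elim_mx i r)^T =
    elim_mx j r' *m A1 *m (elim_mx j r')^T.
  by rewrite trmx_mul /A1 !mulmxA.
split.
- by rewrite trmx_mul; apply: upper_mxM => //; apply: elim_mxT_upper.
- by rewrite unitmx_mul u1 andbT -unitmx_tr elim_mxT_unit.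
- exact: blockwiseM.
- have A2E p q : (elim_mx j r' *m A1 *m (elim_mx j r')^T) p q =
      A1 p q - r' p * A1 j q - A1 p j * r' q.
    by rewrite elim_congE A1jj mulr0 subr0.
  have r'j : r' j = 0 by apply: r'0.
  move=> p; rewrite !inE => /or3P[/eqP->|/eqP->|Sp].
  + exists j; rewrite !inE eqxx orbT A2E A1jj mulr0 r'j mulr0 !subr0 A1ij.
    split=> // q neq_q; rewrite A2E (A1C i j) /r' (negPf neq_ij) (negPf neq_q) eqxx.
    have [->|neq_qi] := eqVneq q i; first by field; rewrite nz2 nz_ji.
    by rewrite (A1C j q) A1j // (A1C q i); field; rewrite oner_eq0 nz_ji nz2.
  + exists i; rewrite !inE eqxx A2E A1jj r'j !mul0r !subr0.
    split=> // q neq_q; rewrite A2E A1jj r'j !mul0r !subr0 A1C; exact: A1j.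
  + have [q [Sq nz_q all0]] := mA p Sp; exists q; rewrite !inE Sq !orbT.
    have neq_pi : p != i by apply: contraNneq nSi => <-.
    have A2S q' : (elim_mx j r' *m A1 *m (elim_mx j r')^T) p q' = A p q'.
      by rewrite A2E r'S // A1j // !mul0r !subr0 A1S.
    by rewrite A2S; split=> // q' /all0 <-; rewrite A2S.
- rewrite !cardsU1 !inE negb_or neq_ij nSi nSj /=; by rewrite add1n ltnS leq_addl.
Qed.

Lemma sym_monomial be A : (2%:R : F) != 0 ->
  A^T = A -> A \in unitmx -> blockwise be A ->
  exists b, [/\ upper_mx b^T, b \in unitmx, blockwise be b &
    monomial_on finset.setT (b *m A *m b^T)].
Proof.
move=> nz2 sA uA bA.
suff H m (S : {set 'I_n}) : (n - #|S| <= m)%N -> forall A, A^T = A -> A \in unitmx -> blockwise be A ->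
    monomial_on S A -> exists b, [/\ upper_mx b^T, b \in unitmx, blockwise be b &
    monomial_on finset.setT (b *m A *m b^T)].
  by apply: (H n finset.set0); rewrite ?leq_subr // => p; rewrite inE.
elim: m S => [|m IHm] S le_m {}A {}sA {}uA {}bA mA.
  exists 1%:M; rewrite trmx1 mul1mx mulmx1 unitmx1; split=> //.
  - by move=> i j lt_ji; rewrite mxE -val_eqE gtn_eqF.
  - by move=> i j; rewrite mxE; case: (eqVneq i j) => [->//|_]; rewrite mulr0n eqxx.
  suff <- : S = finset.setT by [].
  apply/eqP; rewrite eqEcard finset.subsetT cardsT card_ord.
  by rewrite leqn0 subn_eq0 in le_m.
have [ST|neqST] := eqVneq S finset.setT.
  exists 1%:M; rewrite trmx1 mul1mx mulmx1 unitmx1 -ST; split=> //.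
  - by move=> i j lt_ji; rewrite mxE -val_eqE gtn_eqF.
  - by move=> i j; rewrite mxE; case: (eqVneq i j) => [->//|_]; rewrite mulr0n eqxx.
have [b [S' [upb ub bb mb ltSS']]] := sym_elim_step nz2 sA uA bA mA neqST.
have [||||b' [upb' ub' bb' mb']] := IHm S' _ (b *m A *m b^T) _ _ _ mb.
- by have := max_card (mem S'); rewrite card_ord => ?; lia.
- exact: congr_sym.
- by rewrite !unitmx_mul ub uA unitmx_tr.
- exact: blockwiseM (blockwiseM bb bA) (blockwise_tr bb).
exists (b' *m b); split.
- by rewrite trmx_mul; apply: upper_mxM.
- by rewrite unitmx_mul ub ub'.
- exact: blockwiseM.
- by rewrite trmx_mul !mulmxA in mb' *.
Qed.

End Elimination.

(** By symmetry the monomial matrix reached by elimination has the support of an involution. A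
    diagonal congruence makes its entries 1: an inverse square root at a fixed point and, on a
    2-cycle, the inverse entry at the smaller element and 1 at the other. *)
Lemma sym_normal_form (C : numClosedFieldType) (n : nat) (be : 'I_n -> nat) (A : 'M[C]_n) :
  A^T = A -> A \in unitmx -> blockwise be A ->
  exists b, exists s : 'S_n, [/\ upper_mx b, b \in unitmx, blockwise be b,
    (forall i, s (s i) = i) & b^T *m A *m b = perm_mx s].
Proof.
have nz2 : (2%:R : C) != 0 by rewrite pnatr_eq0.
move=> sA uA bA; have [b [upb ub bb mb]] := sym_monomial nz2 sA uA bA.
have [A1 defA1] : exists A1, A1 = b *m A *m b^T by exists (b *m A *m b^T).
rewrite -defA1 in mb.
have mb' p : exists q, A1 p q != 0 by have [q [_ ? _]] := mb p (finset.in_setT p); exists q.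
pose f p := xchoose (mb' p); have fP p : A1 p (f p) != 0 := xchooseP (mb' p).
have f0 p q : q != f p -> A1 p q = 0.
  have [q' [_ nz_q' all0]] := mb p (finset.in_setT p).
  suff -> : f p = q' by apply: all0.
  by apply/eqP/negPn/negP => /all0/eqP; rewrite (negPf (fP p)).
have A1C p q : A1 p q = A1 q p by rewrite -[in LHS](_ : A1^T = A1) ?mxE // defA1 congr_sym.
have fK : involutive f.
  by move=> p; apply/esym/eqP/negPn/negP => /f0/eqP; rewrite A1C (negPf (fP p)).
pose e := \row_p (if p == f p then (sqrtC (A1 p p))^-1
  else if (p < f p)%N then (A1 p (f p))^-1 else 1 : C).
have eP p : e 0 p * A1 p (f p) * e 0 (f p) = 1.
  rewrite !mxE fK (eq_sym (f p)); case: (eqVneq p (f p)) => [eq_p|neq_p].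
    by rewrite -!eq_p mulrAC -invfM -expr2 sqrtCK mulVf //; have := fP p; rewrite -eq_p.
  case: (ltngtP p (f p)) => [lt_p|gt_p|/val_inj eq_p]; last by rewrite -eq_p eqxx in neq_p.
    by rewrite mulVf // mulr1.
  by rewrite mul1r [A1 (f p) p]A1C mulfV.
exists (b^T *m diag_mx e), (perm (inv_inj fK)); split.
- by apply: upper_mxM => //; apply: upper_mx_diag.
- rewrite unitmx_mul unitmx_tr ub; apply: upper_unitP => [|p]; first exact: upper_mx_diag.
  rewrite !mxE eqxx mulr1n; case: (eqVneq p) => [eq_p|_]; last by case: ifP; rewrite ?invr_eq0 ?oner_eq0.
  by rewrite invr_eq0 sqrtC_eq0 {2}eq_p.
- by apply: blockwiseM; [apply: blockwise_tr | apply: blockwise_diag].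
- by move=> p; rewrite !permE.
rewrite trmx_mul trmxK tr_diag_mx -!mulmxA (mulmxA b) (mulmxA (b *m A)) -defA1 mulmxA.
apply/matrixP => p q; rewrite mul_mx_diag [LHS]mxE mul_diag_mx [X in X * _]mxE.
rewrite [RHS]mxE permE [RHS]mxE; case: (eqVneq (f p) q) => [<-|neq_q]; first exact: eP.
by rewrite f0 ?mulr0 ?mul0r // eq_sym.
Qed.

(** * Uniqueness of the normal form *)

Section Uniqueness.

Variable F : fieldType.

Definition graded_upper (m : nat) (s : 'I_m -> nat) (L : 'M[F]_m) :=
  forall i j, L i j != 0 -> i = j \/ (s i < s j)%N.

Definition partial_monomial (m : nat) (N : 'M[F]_m) :=
  (forall i j j', N i j != 0 -> N i j' != 0 -> j = j') /\
  (forall i i' j, N i j != 0 -> N i' j != 0 -> i = i').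

Lemma graded_upper_diag m s (L L' : 'M[F]_m) i : graded_upper s L -> graded_upper s L' ->
  L *m L' = 1%:M -> L i i != 0.
Proof.
move=> uL uL' LL'; have : (L *m L') i i != 0 by rewrite LL' mxE eqxx oner_eq0.
case/mulmx_neq0 => l nz /uL' [eq_l|lt_li]; first by rewrite eq_l in nz.
by case: (uL _ _ nz) => [eq_l|lt_il]; [rewrite -eq_l in nz | lia].
Qed.

Lemma mulmx_rook_row m (N L : 'M[F]_m) i j :
  partial_monomial N -> N i j != 0 -> L j j != 0 -> (N *m L) i j != 0.
Proof.
move=> [rowN _] nzN nzL; rewrite mxE (bigD1 j) //= big1 ?addr0 ?mulf_neq0 //.
move=> l neq_lj; apply/eqP; rewrite mulf_eq0; apply/orP; left.
by apply: contraNT neq_lj => nz; rewrite (rowN _ _ _ nz nzN).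
Qed.

Lemma mulmx_rook_col m (N L : 'M[F]_m) i j :
  partial_monomial N -> N i j != 0 -> L i i != 0 -> (L *m N) i j != 0.
Proof.
move=> [_ colN] nzN nzL; rewrite mxE (bigD1 i) //= big1 ?addr0 ?mulf_neq0 //.
move=> l neq_li; apply/eqP; rewrite mulf_eq0; apply/orP; right.
by apply: contraNT neq_li => nz; rewrite (colN _ _ _ nz nzN).
Qed.

(* In [Q := N L = L'^T N'], the leading entries of the rows are the positions of
   [N] and those of the columns are the positions of [N']. *)
Lemma rook_unique m s (N N' L L' : 'M[F]_m) :
  graded_upper s L -> graded_upper s L' -> L *m L' = 1%:M -> N' = L^T *m N *m L ->
  partial_monomial N -> partial_monomial N' -> forall i j, N i j != 0 -> N' i j != 0.
Proof.
move=> uL uL' LL' defN' mN mN'.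
have dL i := graded_upper_diag i uL uL' LL'.
have dL' i := graded_upper_diag i uL' uL (mulmx1C LL').
have QE : N *m L = L'^T *m N'.
  by rewrite defN' !mulmxA -trmx_mul LL' trmx1 mul1mx.
move=> i; have [c] := ubnP (s i); elim: c i => // c IHc i le_ic j nzN.
have := mulmx_rook_row mN nzN (dL j).
rewrite QE => /mulmx_neq0[i']; rewrite mxE => /uL' [->//|lt_i'i] nzN'.
have := mulmx_rook_col mN' nzN' (_ : L'^T i' i' != 0); rewrite mxE dL' -QE => /(_ isT).
case/mulmx_neq0 => j' nz_ij' nzL.
have nzN'2 := IHc i' (leq_trans lt_i'i le_ic) j' nz_ij'.
have ej : j' = j := mN'.1 _ _ _ nzN'2 nzN'; rewrite ej in nz_ij'.
by rewrite (mN.2 _ _ _ nzN nz_ij').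
Qed.

Section Sets.

Variables k n : nat.
Implicit Types (a b : 'I_(ext_dim k n)) (be : 'I_n -> nat) (s : 'S_n).

Lemma ext_pow_perm s a b :
  (ext_pow k (perm_mx s : 'M[F]_n) a b != 0) = (iset b == s @: iset a)%SET.
Proof.
have iset_perm c : ext_pow k (perm_mx s : 'M[F]_n) a c != 0 -> iset c = (s @: iset a)%SET.
  case/ext_pow_neq0 => t tP; apply/esym/eqP; rewrite eqEcard.
  rewrite (card_imset _ (@perm_inj _ s)) !card_iset leqnn andbT.
  apply/fintype.subsetP => _ /imsetP[_ /imsetP[p _ ->] ->].
  have := tP p; rewrite !mxE; case: (s _ =P _) => [-> _|_]; last by rewrite eqxx.
  exact: imset_f.
apply/idP/eqP => [/iset_perm//|eq_b].
have [c nz_c] := unitmx_row_neq0 a (ext_pow_unit k (unitmx_perm F s)).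
by have /iset_inj-> : iset b = iset c by rewrite eq_b (iset_perm c).
Qed.

Lemma weight_iset be a : weight be a = (\sum_(x in iset a) be x)%N.
Proof. by rewrite /weight (big_iset _ a be). Qed.

Lemma lim_ext_perm_neq0 be s a b : (forall i, be (s i) = be i) ->
  (lim_ext k be (perm_mx s : 'M[F]_n) a b != 0) = min_weight be a && (iset b == s @: iset a)%SET.
Proof.
move=> bes; rewrite lim_extE -ext_pow_perm.
case: (boolP (min_weight be a)) => //= min_a; last by rewrite eqxx.
case: (boolP (min_weight be b)) => //= nmin_b; rewrite eqxx; apply/esym/negbTE.
apply: contra nmin_b; move=> nz; apply/forallP => c.
rewrite -(weight_ext_pow (be := be) _ nz); first exact: (forallP min_a).
by move=> i j; rewrite !mxE; case: (s i =P j) => [<-|]; rewrite ?bes ?eqxx.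
Qed.

Lemma lim_ext_perm_monomial be s : (forall i, be (s i) = be i) ->
  partial_monomial (lim_ext k be (perm_mx s : 'M[F]_n)).
Proof.
move=> bes; split=> [a b b'|a a' b]; rewrite !lim_ext_perm_neq0 //.
  by move=> /andP[_ /eqP eq_b] /andP[_ /eqP]; rewrite -eq_b => /iset_inj.
move=> /andP[_ /eqP->] /andP[_ /eqP]; by move=> /(imset_inj (@perm_inj _ s))/iset_inj.
Qed.

Lemma min_weight_ex be s a : (forall i, be (s i) = be i) -> min_weight be a ->
  exists b, lim_ext k be (perm_mx s : 'M[F]_n) a b != 0.
Proof.
move=> bes min_a; have [b eq_b] : exists b : 'I_(ext_dim k n), iset b = (s @: iset a)%SET.
  by apply: iset_ex; rewrite (card_imset _ (@perm_inj _ s)) card_iset.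
by exists b; rewrite lim_ext_perm_neq0 // min_a eq_b /=.
Qed.

Lemma swap_iset a x y : x \notin iset a -> y \in iset a ->
  exists2 b : 'I_(ext_dim k n), iset b = (x |: (iset a :\ y))%SET &
    forall be, (weight be b + be y = weight be a + be x)%N.
Proof.
move=> nx yin; have nx' : x \notin (iset a :\ y)%SET by rewrite !inE (negPf nx) andbF.
have [b eq_b] : exists b : 'I_(ext_dim k n), iset b = (x |: (iset a :\ y))%SET.
  by apply: iset_ex; rewrite cardsU1 nx'; have := card_iset a; rewrite (cardsD1 y (iset a)) yin.
exists b => // be; rewrite !weight_iset eq_b big_setU1 //= (big_setD1 y yin) /=; lia.
Qed.

Lemma min_weight_swap be a x y : min_weight be a -> x \notin iset a -> y \in iset a ->
  (be y <= be x)%N.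
Proof.
move=> /forallP min_a nx yin; have [b _ /(_ be)] := swap_iset nx yin.
by have := min_a b; lia.
Qed.

Lemma min_weight_threshold be a c :
  (forall y, y \in iset a -> be y <= c)%N -> (forall x, x \notin iset a -> c <= be x)%N ->
  min_weight be a.
Proof.
move=> le_c ge_c; apply/forallP => b; rewrite !weight_iset.
rewrite (big_setID (iset b)) /= [X in (_ <= X)%N](big_setID (iset a)) /= finset.setIC leq_add2l.
apply: (@leq_trans (\sum_(x in (iset a :\: iset b)%SET) c)).
  by apply: leq_sum => y; rewrite inE => /andP[_ /le_c].
apply: (@leq_trans (\sum_(x in (iset b :\: iset a)%SET) c)); last first.
  by apply: leq_sum => x; rewrite inE => /andP[/ge_c].
rewrite !sum_nat_const leq_mul2r; apply/orP; right.
have := cardsID (iset b) (iset a); have := cardsID (iset a) (iset b).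
rewrite !card_iset finset.setIC; lia.
Qed.

End Sets.

(** Levels without gaps, starting at 0: such a level function is determined by the preorder it
    induces, that is, by the ordered set partition. *)
Definition initial_image (n : nat) (be : 'I_n -> nat) :=
  forall i c, be i = c.+1 -> exists j, be j = c.

Lemma initial_image_le (n : nat) (be be' : 'I_n -> nat) : initial_image be ->
  (forall i j, be i < be j -> be' i < be' j)%N -> forall i, (be i <= be' i)%N.
Proof.
move=> init lt_be i; move def_c: (be i) => c; elim: c i def_c => // c IHc i def_c.
have [j def_j] := init i c def_c.
by apply: leq_ltn_trans (IHc j def_j) _; apply: lt_be; rewrite def_c def_j.
Qed.

(** Consider subsets of the size of [I0], the set of elements at level at most [be i]; this size is
    below [n] because [j] lies higher. Those of minimal weight contain [i] and not [j]. Were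
    [be' j <= be' i], exchanging [i] for [j] in one of them would give another one. *)
Lemma lt_of_min_weight (n : nat) (be be' : 'I_n -> nat) :
  (forall (k : 'I_n.-1) (a : 'I_(ext_dim k.+1 n)), min_weight be a = min_weight be' a) ->
  forall i j, (be i < be j)%N -> (be' i < be' j)%N.
Proof.
move=> eq_min i j lt_ij; pose I0 := [set x | be x <= be i]%SET%N.
have iI : i \in I0 by rewrite inE.
have jI : j \notin I0 by rewrite inE -ltnNge.
have I0_gt0 : (0 < #|I0|)%N by apply/card_gt0P; exists i.
have I0_lt : (#|I0|.-1 < n.-1)%N.
  suff : (#|I0| < n)%N by lia.
  rewrite -[X in (_ < X)%N]card_ord -cardsT; apply: proper_card.
  by apply/properP; split; [apply: finset.subsetT | exists j].
pose k := Ordinal I0_lt; have defk : k.+1 = #|I0| by rewrite /= prednK.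
have min_sep (a : 'I_(ext_dim k.+1 n)) : min_weight be a -> (i \in iset a) && (j \notin iset a).
  move=> min_a; have card_a : #|iset a| = #|I0| by rewrite card_iset.
  apply/andP; split; apply: contraT.
    move=> ni; suff eq_a : iset a = I0 by rewrite eq_a iI in ni.
    apply/eqP; rewrite eqEcard card_a leqnn andbT; apply/fintype.subsetP => y yin.
    by rewrite inE (min_weight_swap min_a).
  rewrite negbK => jin; suff : (#|I0| < #|iset a|)%N by rewrite card_a ltnn.
  apply: proper_card; apply/properP; split; last by exists j.
  apply/fintype.subsetP => x; rewrite inE => le_x; apply: contraT => nx.
  by have := min_weight_swap min_a nx jin; rewrite leqNgt (leq_ltn_trans le_x).
have le_kn : (k.+1 <= n)%N by apply: ltnW; apply: ltn_pred_ord.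
have [a min_a] := ex_min_weight be le_kn.
have /andP[ia ja] := min_sep a min_a; rewrite ltnNge; apply/negP => le_ji.
have [b eq_b /(_ be') wb] := swap_iset ja ia.
have : min_weight be' b.
  apply/forallP => c; have : min_weight be' a by rewrite -eq_min.
  by move/forallP/(_ c); lia.
rewrite -eq_min => /min_sep/andP[]; rewrite eq_b !inE eqxx /= orbF => /eqP ij.
by rewrite ij ltnn in lt_ij.
Qed.

(** The nonzero rows of the common supports are the subsets of minimal weight, which recover the
    levels; the columns of the nonzero entries then recover the permutation. *)
Lemma lim_fam_unique (n : nat) (be be' : 'I_n -> nat) (s s' : 'S_n) (h : 'M[F]_n) :
  initial_image be -> initial_image be' ->
  (forall i, be (s i) = be i) -> (forall i, be' (s' i) = be' i) ->
  upper_mx h -> h \in unitmx ->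
  point_of (lim_fam be (perm_mx s)) = point_of (cong_fam h (lim_fam be' (perm_mx s'))) ->
  be =1 be' /\ s = s'.
Proof.
move=> init init' bes bes' uph uh eq_pt.
have supp (k : 'I_n.-1) (a b : 'I_(ext_dim k.+1 n)) :
    (lim_ext k.+1 be (perm_mx s : 'M[F]_n) a b != 0) =
    (lim_ext k.+1 be' (perm_mx s' : 'M[F]_n) a b != 0).
  have mono := @lim_ext_perm_monomial k.+1 n be s bes.
  have mono' := @lim_ext_perm_monomial k.+1 n be' s' bes'.
  have nz : lim_fam be (perm_mx s) k != 0 :> 'M[F]_(ext_dim k.+1 n).
    apply: lim_fam_neq0; first exact: unitmx_perm.
    by move=> i j; rewrite !mxE; case: (s i =P j) => [<-|]; rewrite ?bes ?eqxx.
  have [c nzc] := vline_eqP nz (congr1 (fun x : quadric_point F n => x k) eq_pt).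
  rewrite /cong_fam /lim_fam.
  set N := lim_ext _ _ _ in mono *; set N' := lim_ext _ _ _ in mono' * => defN.
  clearbody N N'.
  have LL' : ext_pow k.+1 h *m ext_pow k.+1 (invmx h) = 1%:M.
    by rewrite -ext_powM mulmxV // ext_pow1.
  have uL : graded_upper (@isum k.+1 n) (ext_pow k.+1 h).
    by move=> i j; apply: ext_pow_upper.
  have uL' : graded_upper (@isum k.+1 n) (ext_pow k.+1 (invmx h)).
    by move=> i j; apply: ext_pow_upper; apply: upper_mx_inv.
  have scaleN x (M : 'M[F]_(ext_dim k.+1 n)) i j : x != 0 -> ((x *: M) i j != 0) = (M i j != 0).
    by move=> nzx; rewrite mxE mulf_eq0 (negPf nzx).
  have monoZ x M : x != 0 -> partial_monomial M -> partial_monomial (x *: M : 'M[F]_(ext_dim k.+1 n)).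
    move=> nzx [rM cM]; split=> i j l; rewrite !scaleN //; [exact: rM | exact: cM].
  apply/idP/idP => nz_ab.
    rewrite -(scaleN c) //.
    apply: (rook_unique uL' uL (mulmx1C LL') _ mono (monoZ _ _ nzc mono') nz_ab).
    rewrite defN -!scalemxAr -!scalemxAl !mulmxA -(mulmxA _ (ext_pow k.+1 h)) LL' mulmx1.
    by rewrite -trmx_mul LL' trmx1 mul1mx.
  apply: (rook_unique uL uL' LL' _ (monoZ _ _ nzc mono') mono).
    by rewrite defN -!scalemxAr -!scalemxAl.
  by rewrite scaleN.
have eq_min (k : 'I_n.-1) (a : 'I_(ext_dim k.+1 n)) : min_weight be a = min_weight be' a.
  apply/idP/idP => min_a.
    have [b] := min_weight_ex bes min_a.
    by rewrite supp lim_ext_perm_neq0 // => /andP[].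
  have [b] := min_weight_ex bes' min_a.
  by rewrite -supp lim_ext_perm_neq0 // => /andP[].
have eq_be : be =1 be'.
  move=> i; apply/eqP; rewrite eqn_leq !initial_image_le //.
    by apply: lt_of_min_weight => k a; rewrite eq_min.
  exact: lt_of_min_weight.
(* [s i] is read off from the subset formed by [i] and all lower levels, which has minimal weight:
   both permutations map it to the same set, and both preserve levels. *)
split=> //; apply/permP => i; pose I0 := [set x | be x < be i]%SET%N.
have niI : i \notin I0 by rewrite inE ltnn.
have bes2 j : be (s' j) = be j by rewrite !eq_be.
(* If [I0] has [n.-1] elements, that subset has size [n], beyond the available degrees; but then [i]
   is alone on its level and fixed by both permutations. *)
have [lt_In|ge_In] := ltnP #|I0| n.-1; last first.
  have only_i x : x \notin I0 -> x = i.
    move=> nx; apply/eqP/negPn/negP => neq_xi.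
    have := max_card (mem (x |: (i |: I0))%SET); rewrite card_ord.
    have nx2 : x \notin (i |: I0)%SET by rewrite in_setU1 negb_or neq_xi nx.
    by rewrite cardsU1 nx2 cardsU1 niI; have := ltn_ord i; lia.
  have -> : s i = i by apply: only_i; rewrite inE bes ltnn.
  by apply/esym/only_i; rewrite inE bes2 ltnn.
have [a eq_a] : exists a : 'I_(ext_dim (Ordinal lt_In).+1 n), iset a = (i |: I0)%SET.
  by apply: iset_ex; rewrite cardsU1 niI.
have min_a : min_weight be a.
  apply: (@min_weight_threshold _ _ _ _ (be i)) => x; rewrite eq_a !inE.
    by case/orP=> [/eqP->|/ltnW].
  by rewrite negb_or -leqNgt => /andP[].
have [b nzb] := min_weight_ex bes min_a; have := nzb.
rewrite supp lim_ext_perm_neq0 // => /andP[_ /eqP eq_b'].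
move: nzb; rewrite lim_ext_perm_neq0 // => /andP[_ /eqP]; rewrite eq_b' eq_a => /setP/(_ (s' i)).
rewrite !imset_f ?inE ?eqxx // => /esym/imsetP[x]; rewrite !inE => /orP[/eqP->->//|].
by move=> lt_x /(congr1 be); rewrite bes bes2 => eq_be_i; rewrite eq_be_i ltnn in lt_x.
Qed.

End Uniqueness.

(** * Rings of functions and multihomogeneous polynomials *)

Section FunctionRings.

Variables (T : Type) (F : fieldType).

(** Serves for polynomial functions of one parameter and for the regular functions on the chart;
    closure under determinants, adjugates and exterior powers is proved once for both. *)
Record function_ring (S : (T -> F) -> Prop) : Prop := FunctionRing {
  fring_cst : forall c, S (fun=> c);
  fring_add : forall f g, S f -> S g -> S (fun x => f x + g x);
  fring_mul : forall f g, S f -> S g -> S (fun x => f x * g x) }.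

Variables (S : (T -> F) -> Prop) (SR : function_ring S).

Lemma fring_eq f g : f =1 g -> S g -> S f.
Proof. by move=> /boolp.funext ->. Qed.

Lemma fring_sum (I : Type) (r : seq I) (P : pred I) (f : I -> T -> F) :
  (forall i, P i -> S (f i)) -> S (fun x => \sum_(i <- r | P i) f i x).
Proof.
move=> Sf; elim: r => [|i r IHr].
  by apply: fring_eq (fring_cst SR _) => x; rewrite big_nil.
case Pi : (P i); last by apply: fring_eq IHr => x; rewrite big_cons Pi.
by apply: fring_eq (fring_add SR (Sf i Pi) IHr) => x; rewrite big_cons Pi.
Qed.

Lemma fring_prod (I : Type) (r : seq I) (P : pred I) (f : I -> T -> F) :
  (forall i, P i -> S (f i)) -> S (fun x => \prod_(i <- r | P i) f i x).
Proof.
move=> Sf; elim: r => [|i r IHr].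
  by apply: fring_eq (fring_cst SR _) => x; rewrite big_nil.
case Pi : (P i); last by apply: fring_eq IHr => x; rewrite big_cons Pi.
by apply: fring_eq (fring_mul SR (Sf i Pi) IHr) => x; rewrite big_cons Pi.
Qed.

Lemma fring_exp f m : S f -> S (fun x => f x ^+ m).
Proof.
move=> Sf; elim: m => [|m IHm]; first by apply: fring_cst.
by apply: fring_eq (fring_mul SR Sf IHm) => x; rewrite exprS.
Qed.

Lemma fring_opp f : S f -> S (fun x => - f x).
Proof.
by move=> Sf; apply: fring_eq (fring_mul SR (fring_cst SR (-1)) Sf) => x; rewrite mulN1r.
Qed.

Lemma fring_det (m : nat) (M : T -> 'M[F]_m) :
  (forall i j, S (fun x => M x i j)) -> S (fun x => \det (M x)).
Proof.
move=> SM; apply: fring_sum => s _; apply: fring_mul => //; first exact: fring_cst.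
exact: fring_prod.
Qed.

Lemma fring_mulmx (m p q : nat) (M : T -> 'M[F]_(m, p)) (N : T -> 'M[F]_(p, q)) :
  (forall i j, S (fun x => M x i j)) -> (forall i j, S (fun x => N x i j)) ->
  forall i j, S (fun x => (M x *m N x) i j).
Proof.
move=> SM SN i j; under [X in S X]boolp.funext => x do rewrite mxE.
by apply: fring_sum => l _; apply: fring_mul.
Qed.

Lemma fring_tr (m p : nat) (M : T -> 'M[F]_(m, p)) :
  (forall i j, S (fun x => M x i j)) -> forall i j, S (fun x => (M x)^T i j).
Proof. by move=> SM i j; under [X in S X]boolp.funext => x do rewrite mxE. Qed.

Lemma fring_adj (m : nat) (M : T -> 'M[F]_m) :
  (forall i j, S (fun x => M x i j)) -> forall i j, S (fun x => \adj (M x) i j).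
Proof.
move=> SM i j; under [X in S X]boolp.funext => x do rewrite mxE.
apply: fring_mul => //; first exact: fring_cst.
by apply: fring_det => p q; under [X in S X]boolp.funext => x do rewrite !mxE.
Qed.

Lemma fring_ext_pow (k n : nat) (M : T -> 'M[F]_n) :
  (forall i j, S (fun x => M x i j)) -> forall a b, S (fun x => ext_pow k (M x) a b).
Proof.
move=> SM a b; under [X in S X]boolp.funext => x do rewrite ext_powE.
by apply: fring_det => i j; under [X in S X]boolp.funext => x do rewrite mxE.
Qed.

Lemma fring_meval (m : nat) (p : {mpoly F[m]}) (v : T -> 'I_m -> F) :
  (forall i, S (fun x => v x i)) -> S (fun x => p.@[v x]).
Proof.
move=> Sv; under [X in S X]boolp.funext => x do rewrite mevalE.
apply: fring_sum => e _; apply: fring_mul => //; first exact: fring_cst.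
by apply: fring_prod => i _; apply: fring_exp.
Qed.

End FunctionRings.

Section PolynomialFunctions.

Variable C : numClosedFieldType.

Definition polyfun (f : C -> C) := exists p : {poly C}, forall s, f s = p.[s].

Lemma polyfun_ring : function_ring polyfun.
Proof.
split=> [c|f g [p pP] [q qP]|f g [p pP] [q qP]].
- by exists c%:P => s; rewrite hornerC.
- by exists (p + q) => s; rewrite hornerD pP qP.
- by exists (p * q) => s; rewrite hornerM pP qP.
Qed.

Lemma polyfun_id : polyfun id.
Proof. by exists 'X => s; rewrite hornerX. Qed.

Lemma poly_neq0_nonroot (p : {poly C}) : p != 0 -> exists s, p.[s] != 0.
Proof.
move=> nzp; pose rs : seq C := [seq i%:R | i <- iota 0 (size p)].
have uniq_rs : uniq rs by rewrite map_inj_uniq ?iota_uniq //; apply: mulrIn; rewrite oner_eq0.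
have [all_r|] := boolP (all (root p) rs).
  by have := max_poly_roots nzp all_r uniq_rs; rewrite size_map size_iota ltnn.
by case/allPn => s _ nr; exists s.
Qed.

(** A nonzero polynomial times ['X] has a nonroot, which cannot be 0. This takes the place of
    continuity in the passage to the limit. *)
Lemma polyfun_eq0 f : polyfun f -> (forall s, s != 0 -> f s = 0) -> f 0 = 0.
Proof.
move=> [p pP] f0; have [p0|nzp] := eqVneq p 0; first by rewrite pP p0 horner0.
have [|s] := @poly_neq0_nonroot (p * 'X); first by rewrite mulf_neq0 ?polyX_eq0.
rewrite hornerM hornerX -pP; have [->|/f0->] := eqVneq s 0; by rewrite ?mulr0 ?mul0r eqxx.
Qed.

End PolynomialFunctions.

Section MultiHomogeneous.

Variables (F : fieldType) (K : finType) (N : K -> nat).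
Local Notation poly := {mpoly F[#|{: entry N}|]}.
Implicit Types (p q : poly) (d : K -> nat).

Definition mhom d p := forall m, m \in msupp p -> forall k,
  (\sum_(j < #|{: entry N}| | tag (enum_val j) == k) m j)%N = d k.

Lemma mhomD d p q : mhom d p -> mhom d q -> mhom d (p + q).
Proof. by move=> hp hq m /msuppD_le; rewrite mem_cat => /orP[/hp|/hq]. Qed.

Lemma mhomM d e p q : mhom d p -> mhom e q -> mhom (fun k => d k + e k)%N (p * q).
Proof.
move=> hp hq m /msuppM_le/allpairsP[[m1 m2] /= [in1 in2 ->]] k.
under eq_bigr => j _ do rewrite mnmDE.
by rewrite big_split /= hp // hq.
Qed.

Lemma mhomC c : mhom (fun=> 0%N) c%:MP.
Proof.
move=> m; rewrite msuppC; case: ifP => // _; rewrite mem_seq1 => /eqP-> k.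
by rewrite big1 // => j _; rewrite mnm0E.
Qed.

Lemma mhom1 : mhom (fun=> 0%N) 1.
Proof. by rewrite -mpolyC1; apply: mhomC. Qed.

Lemma mhom0 d : mhom d 0.
Proof. by move=> m; rewrite msupp0. Qed.

Lemma mhomZ d c p : mhom d p -> mhom d (c *: p).
Proof. by move=> hp m /msuppZ_le/hp. Qed.

Lemma mhom_sum d (I : Type) (r : seq I) (P : pred I) (f : I -> poly) :
  (forall i, P i -> mhom d (f i)) -> mhom d (\sum_(i <- r | P i) f i).
Proof. by move=> hf; apply: big_ind => //; [apply: mhom0 | apply: mhomD]. Qed.

Lemma mhom_ext d e p : d =1 e -> mhom d p -> mhom e p.
Proof. by move=> eq_de hp m /hp h k; rewrite h eq_de. Qed.

Lemma mhom_prod (I : Type) (r : seq I) (P : pred I) (d : I -> K -> nat) (f : I -> poly) :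
  (forall i, P i -> mhom (d i) (f i)) ->
  mhom (fun k => \sum_(i <- r | P i) d i k)%N (\prod_(i <- r | P i) f i).
Proof.
move=> hf; elim: r => [|i r IHr].
  by rewrite big_nil; apply: mhom_ext _ mhom1 => k; rewrite big_nil.
rewrite big_cons; case: ifP => Pi.
  by apply: mhom_ext _ (mhomM (hf i Pi) IHr) => k; rewrite big_cons Pi.
by apply: mhom_ext _ IHr => k; rewrite big_cons Pi.
Qed.

Lemma mhom_exp d p m : mhom d p -> mhom (fun k => m * d k)%N (p ^+ m).
Proof.
move=> hp; elim: m => [|m IHm]; first exact: mhom1.
by rewrite exprS; apply: mhom_ext _ (mhomM hp IHm) => k; rewrite mulSn.
Qed.

Definition entry_idx k (a b : 'I_(N k)) : 'I_#|{: entry N}| :=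
  enum_rank (Tagged (fun k => ('I_(N k) * 'I_(N k))%type) (a, b)).

Lemma coords_entry (v : forall k, 'M[F]_(N k)) k (a b : 'I_(N k)) :
  coords v (entry_idx a b) = v k a b.
Proof. by rewrite /coords enum_rankK. Qed.

Definition linear_form k (M : 'M[F]_(N k)) : poly :=
  \sum_a \sum_b M a b *: 'X_(entry_idx a b).

Lemma linear_form_mhom k (M : 'M[F]_(N k)) : mhom (fun l => (l == k) : nat) (linear_form M).
Proof.
apply: mhom_sum => a _; apply: mhom_sum => b _; apply: mhomZ => m.
rewrite msuppX mem_seq1 => /eqP-> l.
rewrite big_mkcond (bigD1 (entry_idx a b)) //= enum_rankK /= mnm1E eqxx eq_sym.
rewrite big1 ?addn0; first by case: ifP.
by move=> j /negPf neq_j; case: ifP; rewrite // mnm1E (eq_sym _ j) neq_j.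
Qed.

Lemma linear_formE k (M : 'M[F]_(N k)) v :
  (linear_form M).@[coords v] = \sum_a \sum_b M a b * v k a b.
Proof.
rewrite raddf_sum; apply: eq_bigr => a _; rewrite raddf_sum; apply: eq_bigr => b _.
by rewrite /= mevalZ mevalXU coords_entry.
Qed.

Lemma mhom_multihomogeneous d p : mhom d p -> multihomogeneous p.
Proof. by move=> hp; exists d. Qed.

End MultiHomogeneous.

(** * Limit points lie in the closure *)

Section LimitPoints.

Variables (C : numClosedFieldType) (n : nat).
Local Notation family := (forall k : 'I_n.-1, 'M[C]_(ext_dim k.+1 n)).

(* A polynomial vanishing on the curve [T_s A T_s], [s != 0], vanishes at its limit. *)
Lemma lim_fam_complete (be : 'I_n -> nat) (A : 'M[C]_n) :
  A^T = A -> A \in unitmx -> blockwise be A ->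
  complete_quadrics C n (point_of (lim_fam be A)).
Proof.
move=> sA uA bA; have nz_lim k : lim_fam be A k != 0 by apply: lim_fam_neq0.
split.
  by move=> k X /vlineP[c ->]; rewrite linearZ /= lim_ext_tr sA.
split; first exact: point_of_multipoint.
move=> p hp vanish v spanv.
have le_kn (k : 'I_n.-1) : (k.+1 <= n)%N by apply: ltnW; apply: ltn_pred_ord.
have [m mP] : exists m : 'I_n.-1 -> nat, forall (k : 'I_n.-1) (a : 'I_(ext_dim k.+1 n)),
    (m k <= weight be a)%N /\ (min_weight be a = (weight be a == m k)).
  have ex_a k := ex_min_weight be (le_kn k).
  exists (fun k => weight be (xchoose (ex_a k))) => k a.
  have /forallP min_k := xchooseP (ex_a k); split; first exact: min_k.
  apply/forallP/eqP => [min_a|-> //].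
  by apply/eqP; rewrite eqn_leq min_a min_k.
have [c cP] : exists c : 'I_n.-1 -> C, forall k, c k != 0 /\ v k = c k *: lim_fam be A k.
  have ex_c k : exists c, c != 0 /\ v k = c *: lim_fam be A k.
    have [z nzz ->] := vline_eqP (nz_lim k) (spanv k).
    by exists z^-1; rewrite invr_eq0 nzz scalerA mulVf // scale1r.
  by have [f fP] := boolp.choice ex_c; exists f.
(* Dividing component [k] by [s ^+ (2 * m k)], where [m k] is the minimal weight, leaves exponents
   that are natural numbers, so the curve extends to 0, where only pairs of subsets of minimal
   weight survive. *)
pose w (s : C) : family := fun k => \matrix_(a, b)
  (c k * s ^+ (weight be a + weight be b - 2 * m k) * ext_pow k.+1 A a b).
have w0 : w 0 = v.
  apply: functional_extensionality_dep => k; rewrite (cP k).2.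
  apply/matrixP => a b; rewrite [LHS]mxE [RHS]mxE lim_extE.
  have [le_a ->] := mP k a; have [le_b ->] := mP k b.
  rewrite expr0n; case: ifP => [/andP[/eqP-> /eqP->]|neq].
    by rewrite mul2n -addnn subnn eqxx mulr1.
  suff -> : (weight be a + weight be b - 2 * m k == 0)%N = false by rewrite !(mulr0, mul0r).
  apply/negbTE; move: neq; lia.
rewrite -w0; apply: (@polyfun_eq0 C (fun s => p.@[coords (w s)])).
  apply: (fring_meval (polyfun_ring C)) => j.
  rewrite /coords; case: (enum_val j) => k [a b] /=.
  under [X in polyfun X]boolp.funext => s do rewrite mxE.
  apply: (fring_mul (polyfun_ring C)); last exact: (fring_cst (polyfun_ring C)).
  apply: (fring_mul (polyfun_ring C)); first exact: (fring_cst (polyfun_ring C)).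
  exact: (fring_exp (polyfun_ring C) _ (polyfun_id C)).
move=> s nzs; pose T := diag_mx (\row_i s ^+ be i) : 'M[C]_n.
have uT : T \in unitmx.
  apply: upper_unitP => [|i]; first exact: upper_mx_diag.
  by rewrite !mxE eqxx mulr1n expf_neq0.
apply: (vanish (ext_lines (T *m A *m T))).
  exists (T *m A *m T); rewrite !unitmx_mul uT uA; split=> //.
  by rewrite !trmx_mul tr_diag_mx sA mulmxA.
move=> k; rewrite /ext_lines.
have -> : w s k = (c k * s ^- (2 * m k)) *: ext_pow k.+1 (T *m A *m T).
  apply/matrixP => a b; rewrite [LHS]mxE [RHS]mxE.
  have -> : ext_pow k.+1 (T *m A *m T) a b =
      s ^+ weight be a * ext_pow k.+1 A a b * s ^+ weight be b.
    rewrite !ext_powM ext_pow_diag mul_mx_diag [LHS]mxE mul_diag_mx [X in X * _]mxE.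
    rewrite ![(\row__ _) _ _]mxE; congr (_ * _ * _);
    by rewrite /weight expr_sum; apply: eq_bigr => i _; rewrite mxE.
  have [le_a _] := mP k a; have [le_b _] := mP k b.
  have -> : s ^+ (weight be a + weight be b - 2 * m k) =
      s ^- (2 * m k) * s ^+ weight be a * s ^+ weight be b.
    apply: (mulfI (expf_neq0 (2 * m k) nzs)); rewrite -!mulrA mulVKf ?expf_neq0 //.
    by rewrite -!exprD; congr (_ ^+ _); lia.
  move: (s ^- _) (s ^+ weight be a) (s ^+ weight be b) (ext_pow _ _ a b) => z x y e.
  by ring.
by rewrite vline_scale // mulf_neq0 ?invr_eq0 ?expf_neq0 // (cP k).1.
Qed.

End LimitPoints.

(** * Frames with nonzero leading coefficients *)

Section GenericFrames.

Variables (C : numClosedFieldType) (n : nat).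
Local Notation family := (forall k : 'I_n.-1, 'M[C]_(ext_dim k.+1 n)).
Implicit Types (g h A : 'M[C]_n) (v w : family) (k : 'I_n.-1).

Lemma hook_proof k (j : 'I_n) : exists a : 'I_(ext_dim k.+1 n),
  [forall i : 'I_k.+1, (basis_incr a i == (if i < k then i : nat else maxn k j) :> nat)%N].
Proof.
have lt_n (i : 'I_k.+1) : ((if i < k then i : nat else maxn k j) < n)%N.
  by have := ltn_pred_ord k; have := ltn_ord j; have := ltn_ord i; case: ifP; lia.
have [|a aP] := @basis_incr_ex k.+1 n (fun i => Ordinal (lt_n i)).
  move=> i l lt_il /=; have := ltn_ord l; case: (ltnP i k); case: (ltnP l k) => //; lia.
by exists a; apply/forallP => i; rewrite aP.
Qed.

(* The index set {0, ..., k - 1, max k j}. *)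
Definition hook k (j : 'I_n) := xchoose (hook_proof k j).

Definition lead k := hook k (pos k).

Lemma hookE k (j : 'I_n) (i : 'I_k.+1) :
  basis_incr (hook k j) i = (if (i < k)%N then i : nat else maxn k j) :> nat.
Proof. by have /forallP/(_ i)/eqP := xchooseP (hook_proof k j). Qed.

Lemma leadE k (i : 'I_k.+1) : basis_incr (lead k) i = i :> nat.
Proof. by rewrite hookE /= maxnn; case: ltnP => // le_ki; have := ltn_ord i; lia. Qed.

Lemma lead_min k (a : 'I_(ext_dim k.+1 n)) : (isum (lead k) <= isum a)%N.
Proof. by apply: leq_sum => i _; rewrite leadE leq_basis_incr. Qed.

(** The value of the quadratic form [v k] at the exterior product of the first [k.+1] columns of
    [g]. *)
Definition lead_coef_of g v k := cong_fam g v k (lead k) (lead k).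

Lemma cong_famE g v k a b : cong_fam g v k a b =
  \sum_c \sum_d ext_pow k.+1 g c a * v k c d * ext_pow k.+1 g d b.
Proof.
rewrite exchange_big mxE; apply: eq_bigr => d _; rewrite mxE mulr_suml.
by apply: eq_bigr => c _; rewrite [_^T _ _]mxE.
Qed.

(** For the permutation matrix P of an involution, (1 + i P)^2 = 2 i P, so a multiple of 1 + i P is
    a symmetric square root of P. *)
Lemma sym_factor A : A^T = A -> A \in unitmx -> exists G : 'M[C]_n, A = G *m G^T.
Proof.
move=> sA uA; have [//|b [s [_ ub _ sK def_s]]] := @sym_normal_form C n (fun=> 0%N) A sA uA.
pose al : C := sqrtC ((2%:R * 'i)^-1).
have ss : perm_mx s *m perm_mx s = 1%:M :> 'M[C]_n.
  rewrite -perm_mxM (_ : s * s = 1)%g ?perm_mx1 //.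
  by apply/permP => i; rewrite permM perm1 sK.
have sT : (perm_mx s)^T = perm_mx s :> 'M[C]_n.
  by rewrite tr_perm_mx; congr perm_mx; apply/permP => i; apply: (@perm_inj _ s); rewrite permKV sK.
pose Q : 'M[C]_n := al *: (1%:M + 'i *: perm_mx s).
have QT : Q^T = Q by rewrite linearZ /= linearD /= trmx1 linearZ /= sT.
have QQ : Q *m Q = perm_mx s.
  rewrite /Q -scalemxAl -scalemxAr scalerA -expr2 sqrtCK.
  rewrite mulmxDl !mulmxDr !mul1mx !mulmx1 -scalemxAl -scalemxAr scalerA ss -expr2 sqrCi.
  rewrite scaleN1r (addrC 1%:M) addrACA subrr addr0 -scalerDl scalerA -mulr2n -(mulr_natl 'i).
  by rewrite mulVf ?scale1r // mulf_neq0 ?neq0Ci ?pnatr_eq0.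
exists (Q *m invmx b)^T; rewrite trmxK trmx_mul QT mulmxA -(mulmxA _ Q Q) QQ -def_s !mulmxA.
by rewrite trmx_inv mulVmx ?unitmx_tr // mul1mx -mulmxA mulmxV // mulmx1.
Qed.

(* The functional conjugate to [v k] would otherwise vanish on the exterior
   powers of all matrices [G G^T], hence on the closure, hence at [v k]. *)
Lemma ex_lead_coef_neq0 v k : zariski_closure (nondeg_quadrics C n) (point_of v) ->
  v k != 0 -> exists g, lead_coef_of g v k != 0.
Proof.
move=> [_ closv] nzv; apply: contrapT => no_g.
have lam0 g : lead_coef_of g v k = 0.
  by apply/eqP/negPn/negP => nz; apply: no_g; exists g.
pose N := fun k : 'I_n.-1 => ext_dim k.+1 n.
pose p := linear_form (map_mx Num.conj (v k) : 'M[C]_(N k)).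
suff : p.@[coords v] = 0.
  rewrite linear_formE => /eqP.
  rewrite psumr_eq0 => [/allP sum0|a _]; last first.
    by apply: sumr_ge0 => b _; rewrite mxE mulrC mul_conjC_ge0.
  case/eqP: nzv; apply/matrixP => a b; rewrite [RHS]mxE.
  have /= := sum0 a (mem_index_enum a).
  rewrite psumr_eq0 => [/allP/(_ b (mem_index_enum b))|c _]; last first.
    by rewrite mxE mulrC mul_conjC_ge0.
  by rewrite /= mxE mulrC mul_conjC_eq0 => /eqP.
apply: closv => //. by exists (fun l => (l == k) : nat); apply: linear_form_mhom.
move=> _ [A [sA uA ->]] u spanu; rewrite linear_formE.
have /vlineP[c ->] : u k \in <[ext_pow k.+1 A]>%VS.
  by have := spanu k; rewrite /ext_lines => ->; apply: memv_line.
have [G ->] := sym_factor sA uA.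
(* By Cauchy-Binet the exterior power of [G *m G^T] is the sum of u u^T over the column sets [M] of
   [G], with u the decomposable vector of these columns. [gM M] starts with the conjugates of these
   columns, followed by zeros, so its leading coefficient is the conjugate of the value of the
   functional at u u^T. *)
pose gM (M : 'I_(ext_dim k.+1 n)) : 'M[C]_n := \matrix_(x, i)
  oapp (fun i' : 'I_k.+1 => (G x (basis_incr M i'))^*) 0 (insub (i : nat)).
have gME M a : ext_pow k.+1 (gM M) a (lead k) = (ext_pow k.+1 G a M)^*.
  rewrite !ext_powE -det_map_mx; congr (\det _); apply/matrixP => i j; rewrite !mxE.
  by rewrite leadE valK.
transitivity (c * \sum_M (lead_coef_of (gM M) v k)^*); last first.
  by rewrite big1 ?mulr0 // => M _; rewrite lam0 rmorph0.
rewrite mulr_sumr; under [RHS]eq_bigr => M _.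
  rewrite /lead_coef_of cong_famE rmorph_sum mulr_sumr.
  under eq_bigr => a _ do (rewrite rmorph_sum mulr_sumr; under eq_bigr => b _ do
    rewrite !rmorphM /= !gME !conjCK).
  over.
rewrite [RHS]exchange_big; apply: eq_bigr => a _; rewrite [RHS]exchange_big; apply: eq_bigr => b _ /=.
rewrite ext_powM ext_pow_tr [in LHS]mxE [X in _ * X]mxE [X in _ * (_ * X)]mxE !mulr_sumr.
apply: eq_bigr => M _; rewrite [_^T _ _]mxE; ring.
Qed.

(** On the line through a [g] good for the tail of the list and an [h] good for its head, both
    conditions are nonzero polynomials in the parameter, and their product has a nonroot. *)
Lemma common_nonzero (I : eqType) (r : seq I) (P : I -> 'M[C]_n -> C) :
  (forall i g h, polyfun (fun s => P i (g + s *: h))) ->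
  (forall i, exists g, P i g != 0) -> exists g, forall i, i \in r -> P i g != 0.
Proof.
move=> polyP exP; elim: r => [|i r [g gP]]; first by exists 0.
have [h hP] := exP i.
have [p pP] := polyP i g (h - g).
have [q qP] : polyfun (fun s => \prod_(j <- r) P j (g + s *: (h - g))).
  by apply: fring_prod => [|j _]; [apply: polyfun_ring | apply: polyP].
have nzp : p != 0.
  apply: contraNneq hP => p0; have := pP 1.
  by rewrite p0 horner0 scale1r addrC subrK => ->.
have nzq : q != 0.
  have : \prod_(j <- r) P j g != 0 by rewrite prodf_seq_neq0; apply/allP => j /gP.
  by apply: contraNneq => q0; have := qP 0; rewrite q0 horner0 scale0r addr0 => ->.
have [s] := poly_neq0_nonroot (mulf_neq0 nzp nzq).
rewrite hornerM -pP -qP mulf_eq0 negb_or => /andP[nz_i].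
rewrite prodf_seq_neq0 => /allP nz_r.
exists (g + s *: (h - g)) => j; rewrite inE => /orP[/eqP->//|].
exact: nz_r.
Qed.

Lemma generic_frame v : zariski_closure (nondeg_quadrics C n) (point_of v) ->
  (forall k, v k != 0) -> exists2 g, g \in unitmx & forall k, lead_coef_of g v k != 0.
Proof.
move=> closv nzv.
pose P (i : option 'I_n.-1) g := if i is Some k then lead_coef_of g v k else \det g.
have poly_line (g h : 'M[C]_n) i j : polyfun (fun s => (g + s *: h) i j).
  exists ((g i j)%:P + 'X * (h i j)%:P) => s.
  by rewrite !mxE hornerD hornerM hornerX !hornerC.
have [||g gP] := @common_nonzero _ (enum {: option 'I_n.-1}) P.
- case=> [k|] g h /=; last by apply: fring_det; [apply: polyfun_ring | apply: poly_line].
  have PR := polyfun_ring C.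
  apply: (fring_mulmx PR); last by apply: fring_ext_pow.
  apply: (fring_mulmx PR); first by apply: fring_tr; apply: (fring_ext_pow PR).
  by move=> a b; apply: (fring_cst PR).
- case=> [k|]; first exact: ex_lead_coef_neq0.
  by exists 1%:M; rewrite /= det1 oner_eq0.
exists g; first by rewrite unitmxE unitfE; apply: (gP None); rewrite mem_enum.
by move=> k; apply: (gP (Some k)); rewrite mem_enum.
Qed.

End GenericFrames.

(** * Telescoping products and level functions *)

Section Telescoping.

Variables (n : nat).
Implicit Types (x y : 'I_n) (j : 'I_n.-1).

Lemma telescope_prod (F : fieldType) (d : 'I_n -> F) x y :
  (forall i, d i != 0) -> (x <= y)%N ->
  d y = d x * \prod_(j < n.-1 | (x <= j < y)%N) (d (pos_succ j) / d (pos j)).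
Proof.
move=> nzd; case: y => y; elim: y => [|y IHy] lt_yn /= le_xy.
  rewrite big1 ?mulr1 => [|j]; last by rewrite ltn0 andbF.
  by congr d; apply: val_inj => /=; lia.
have [eq_x|neq_x] := eqVneq (x : nat) y.+1.
  rewrite big1 ?mulr1 => [|j]; last by lia.
  by congr d; apply: val_inj.
have lt_y : (y < n.-1)%N by lia.
have le_xy' : (x <= y)%N by lia.
rewrite (bigD1 (Ordinal lt_y)) /=; last by lia.
rewrite (eq_bigl (fun j => (x <= j < y)%N)) => [|j]; last by rewrite -val_eqE /=; lia.
rewrite mulrCA -(IHy (ltnW lt_yn)) //.
rewrite mulrC mulrCA (_ : Ordinal lt_yn = pos_succ (Ordinal lt_y)); last exact: val_inj.
rewrite (_ : Ordinal (ltnW lt_yn) = pos (Ordinal lt_y)); last exact: val_inj.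
by rewrite mulfV ?mulr1.
Qed.

(** The level function obtained by cutting between [j] and [j.+1] whenever [P j]. It serves both for
    the zeros among the ratios of a chart and for the word of a coset representative. *)
Definition marks_before (P : pred 'I_n.-1) x := #|[set j : 'I_n.-1 | (j < x)%N && P j]%SET|.

Lemma marks_before_split P x y : (x <= y)%N ->
  marks_before P y = (marks_before P x + \sum_(j < n.-1 | x <= j < y) P j)%N.
Proof.
have E z : marks_before P z = (\sum_(j < n.-1 | (j < z)%N) P j)%N.
  by rewrite /marks_before -sum1_card -big_mkcondr /=; apply: eq_bigl => j; rewrite inE.
move=> le_xy; rewrite !E (bigID (fun j : 'I_n.-1 => (j < x)%N)) /=.
by congr addn; apply: eq_bigl => j; lia.
Qed.

Lemma leq_marks_before P x y : (x <= y)%N -> (marks_before P x <= marks_before P y)%N.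
Proof. by move=> /(marks_before_split P) ->; apply: leq_addr. Qed.

Lemma marks_before0 P x : x = 0%N :> nat -> marks_before P x = 0%N.
Proof. by move=> x0; apply/eqP; rewrite cards_eq0; apply/eqP/setP => j; rewrite !inE x0 ltn0. Qed.

Lemma marks_before_pos_succ P j :
  marks_before P (pos_succ j) = (marks_before P (pos j) + P j)%N.
Proof.
rewrite (@marks_before_split P (pos j)) //=; congr addn; apply: big_pred1 => l.
by rewrite /= -val_eqE /=; lia.
Qed.

Lemma marks_before_initial P : initial_image (marks_before P).
Proof.
case=> x; elim: x => [|x IHx] lt_xn c; first by rewrite marks_before0.
have lt_x : (x < n.-1)%N by lia.
rewrite (_ : Ordinal lt_xn = pos_succ (Ordinal lt_x)); last exact: val_inj.
rewrite marks_before_pos_succ (_ : pos _ = Ordinal (ltnW lt_xn)); last exact: val_inj.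
case: (P _); last by rewrite addn0; apply: IHx.
by rewrite addn1 => -[<-]; exists (Ordinal (ltnW lt_xn)).
Qed.

Variables (F : fieldType) (t : 'I_n.-1 -> F).

Definition zeros_before := marks_before (fun j => t j == 0).

Definition partial_prod x := \prod_(j < n.-1 | (j < x)%N && (t j != 0)) t j.

Lemma partial_prod_neq0 x : partial_prod x != 0.
Proof. by apply/prodf_neq0 => j /andP[]. Qed.

(** A vanishing factor between [x] and [y] is exactly a change of level; without one, the product is
    a quotient of partial products, which skip the zeros and hence are invertible. *)
Lemma prod_between x y : (x <= y)%N ->
  \prod_(j < n.-1 | (x <= j < y)%N) t j =
  (zeros_before x == zeros_before y)%:R * (partial_prod y / partial_prod x).
Proof.
move=> le_xy; rewrite /zeros_before (marks_before_split _ le_xy) -[X in X == _]addn0 eqn_add2l eq_sym.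
rewrite sum_nat_eq0; case: forallP => [nzt|some0].
  rewrite mul1r; apply: (mulIf (partial_prod_neq0 x)); rewrite mulfVK ?partial_prod_neq0 //.
  rewrite [RHS](bigID (fun j : 'I_n.-1 => (j < x)%N)) /= mulrC; congr (_ * _).
    by apply: eq_bigl => j; case: (t j == 0); lia.
  apply: eq_bigl => j; have := nzt j; case: (t j == 0) => //=; lia.
rewrite mul0r; apply/eqP; apply: contraPT some0 => /prodf_neq0 nzt all0.
by apply: all0 => j; apply/implyP => /nzt /negPf ->.
Qed.

End Telescoping.

(** * The chart of nonzero leading coefficients *)

Section Chart.

Variables (C : numClosedFieldType) (n : nat).
Local Notation family := (forall k : 'I_n.-1, 'M[C]_(ext_dim k.+1 n)).
Local Notation N := (fun k : 'I_n.-1 => ext_dim k.+1 n).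
Implicit Types (A u : 'M[C]_n) (v w : family) (k : 'I_n.-1).

Lemma ext_pow_lead u k a : upper_mx u -> a != lead k -> ext_pow k.+1 u a (lead k) = 0.
Proof.
move=> upu neq_a; apply/eqP; apply: contraNT neq_a => /ext_pow_upper [//|->//|].
by rewrite ltnNge lead_min.
Qed.

Lemma ext_pow_unipotent_lead u k : upper_mx u -> (forall i, u i i = 1) ->
  ext_pow k.+1 u (lead k) (lead k) = 1.
Proof. by move=> upu u1; rewrite ext_pow_upper_diag // big1. Qed.

(** This minor is again upper triangular, with ones on the diagonal except in the last place. *)
Lemma ext_pow_unipotent_hook u k (j : 'I_n) : upper_mx u -> (forall i, u i i = 1) ->
  (k <= j)%N -> ext_pow k.+1 u (lead k) (hook k j) = u (pos k) j.
Proof.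
move=> upu u1 le_kj; rewrite ext_powE det_upper; last first.
  move=> i l lt_li; rewrite mxE upu // leadE hookE ifT //.
  by have := ltn_ord i; lia.
rewrite big_ord_recr /= big1 ?mul1r => [|i _].
  rewrite mxE; congr (u _ _); apply: val_inj => /=; first by rewrite leadE.
  by rewrite hookE ltnn; apply/maxn_idPr.
rewrite mxE (_ : basis_incr (hook k j) _ = basis_incr (lead k) (widen_ord (leqnSn k) i)) ?u1 //.
by apply: val_inj; rewrite /= hookE leadE /= ltn_ord.
Qed.

Lemma mem_iset_lead k (x : 'I_n) : (x \in iset (lead k)) = (x <= k)%N.
Proof.
apply/imsetP/idP => [[i _ ->]|le_xk]; first by rewrite leadE -ltnS.
by exists (Ordinal (le_xk : (x < k.+1)%N)) => //; apply: val_inj; rewrite /= leadE.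
Qed.

(** Write [A] as the congruence of an involution matrix by an upper triangular [c]. The exterior
    powers of [c] act on the leading subset by a scalar, so a nonzero leading minor forces the
    involution to preserve that initial segment; preserving all of them, it is trivial. *)
Lemma LDL_decomposition A : A^T = A -> A \in unitmx ->
  (forall k, ext_pow k.+1 A (lead k) (lead k) != 0) ->
  exists u, exists d : 'rV[C]_n, [/\ upper_mx u, forall i, u i i = 1, forall i, d 0 i != 0 &
    A = u^T *m diag_mx d *m u].
Proof.
move=> sA uA nzA; have [//|b [s [upb ub _ sK def_s]]] := @sym_normal_form C n (fun=> 0%N) A sA uA.
pose c := invmx b; have upc : upper_mx c by apply: upper_mx_inv.
have uc : c \in unitmx by rewrite unitmx_inv.
have defA : A = c^T *m perm_mx s *m c.
  rewrite -def_s !mulmxA -trmx_mul mulmxV // trmx1 mul1mx -mulmxA mulmxV // mulmx1 //.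
have s_le k (x : 'I_n) : (x <= k)%N -> (s x <= k)%N.
  move=> le_xk; suff eq_s : iset (lead k) = (s @: iset (lead k))%SET.
    by rewrite -mem_iset_lead eq_s imset_f // mem_iset_lead.
  apply/eqP; rewrite -(@ext_pow_perm C); apply: contraNneq (nzA k) => nzs.
  have := cong_famE c (fun k => ext_pow k.+1 (perm_mx s)) (lead k) (lead k).
  rewrite /cong_fam -ext_pow_tr -!ext_powM -defA => ->; apply/eqP.
  apply: big1 => a _; apply: big1 => a' _.
  have [->|ne_a] := eqVneq a (lead k); last by rewrite ext_pow_lead // !mul0r.
  have [->|ne_a'] := eqVneq a' (lead k); last by rewrite [X in _ * X]ext_pow_lead // mulr0.
  by rewrite nzs mulr0 mul0r.
have s_le_id x : (s x <= x)%N.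
  have [lt_x|ge_x] := ltnP x n.-1; first exact: (s_le (Ordinal lt_x)).
  by apply: leq_trans ge_x; have := ltn_ord (s x); lia.
have s1 : s = 1%g.
  apply/permP => x; rewrite perm1; apply/val_inj/eqP; rewrite eqn_leq s_le_id.
  by have := s_le_id (s x); rewrite sK.
have nzc i : c i i != 0 by apply: upper_unit_diag.
pose e := \row_i (c i i)^-1 : 'rV[C]_n.
exists (diag_mx e *m c), (\row_i (c i i) ^+ 2); split.
- by apply: upper_mxM => //; apply: upper_mx_diag.
- by move=> i; rewrite mul_diag_mx !mxE mulVf.
- by move=> i; rewrite mxE expf_neq0.
have eK : diag_mx e *m (diag_mx (\row_i c i i ^+ 2) *m diag_mx e) = 1%:M.
  rewrite !mulmx_diag -diag_const_mx; congr diag_mx; apply/rowP => i; rewrite !mxE.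
  by field; rewrite nzc.
rewrite defA s1 perm_mx1 mulmx1 trmx_mul tr_diag_mx !mulmxA -(mulmxA _ _ (diag_mx e)).
by rewrite -(mulmxA _ (diag_mx e)) eK mulmx1.
Qed.

Variables (g : 'M[C]_n) (ug : g \in unitmx).

Local Notation lam := (lead_coef_of g).

Definition entry_poly k (a b : 'I_(ext_dim k.+1 n)) : {mpoly C[#|{: entry N}|]} :=
  @linear_form C _ N k (\matrix_(c, d) (ext_pow k.+1 g c a * ext_pow k.+1 g d b)).

Lemma entry_polyE w k (a b : 'I_(ext_dim k.+1 n)) :
  (entry_poly a b).@[@coords C _ N w] = cong_fam g w k a b.
Proof.
rewrite linear_formE cong_famE; apply: eq_bigr => c _; apply: eq_bigr => d _.
by rewrite mxE mulrAC.
Qed.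

Definition lead_poly := \prod_k entry_poly (lead k) (lead k).

Lemma lead_polyE w : lead_poly.@[@coords C _ N w] = \prod_k lam w k.
Proof. by rewrite rmorph_prod; apply: eq_bigr => k _; apply: entry_polyE. Qed.

Lemma lead_poly_mhom : mhom (fun=> 1%N) lead_poly.
Proof.
have := @mhom_prod C _ N _ (index_enum 'I_n.-1) xpredT (fun k l => (l == k) : nat)
  (fun k => entry_poly (lead k) (lead k)) (fun k _ => @linear_form_mhom C _ N k _).
apply: mhom_ext => k; rewrite -big_mkcond sum1dep_card /=.
by rewrite (eq_card (B := pred1 k)) ?card1 // => l; rewrite !inE eq_sym.
Qed.

(* Functions of multidegree 0, regular where the leading coefficients do not vanish. *)
Definition chart_regular (f : family -> C) := exists m, exists p : {mpoly C[#|{: entry N}|]},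
  mhom (fun=> m) p /\ forall w, (forall k, lam w k != 0) ->
  p.@[@coords C _ N w] = f w * (\prod_k lam w k) ^+ m.

Lemma chart_regular_ring : function_ring chart_regular.
Proof.
split=> [c|f1 f2 [m1 [p1 [hp1 p1E]]] [m2 [p2 [hp2 p2E]]]|
         f1 f2 [m1 [p1 [hp1 p1E]]] [m2 [p2 [hp2 p2E]]]].
- by exists 0%N, c%:MP; split=> [|w _]; [apply: mhomC | rewrite mevalC expr0 mulr1].
- exists (m1 + m2)%N, (p1 * lead_poly ^+ m2 + p2 * lead_poly ^+ m1); split=> [|w nzw].
    apply: mhomD.
      by apply: mhom_ext _ (mhomM hp1 (mhom_exp lead_poly_mhom)) => k; rewrite muln1.
    by apply: mhom_ext _ (mhomM hp2 (mhom_exp lead_poly_mhom)) => k; rewrite muln1 addnC.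
  rewrite mevalD !mevalM !rmorphXn /= !lead_polyE p1E // p2E // exprD; ring.
- exists (m1 + m2)%N, (p1 * p2); split=> [|w nzw]; first exact: mhomM.
  by rewrite mevalM p1E // p2E // exprD; ring.
Qed.

(** The denominator involves component [k] only; multiplying numerator and denominator by the other
    leading coefficients brings the quotient over [lead_poly]. *)
Lemma chart_regular_entry k a b : chart_regular (fun w => (lam w k)^-1 * cong_fam g w k a b).
Proof.
exists 1%N, (entry_poly a b * \prod_(l | l != k) entry_poly (lead l) (lead l)); split=> [|w nzw].
  have := @mhom_prod C _ N _ (index_enum 'I_n.-1) (fun l => l != k) (fun k l => (l == k) : nat)
    (fun k => entry_poly (lead k) (lead k)) (fun k _ => @linear_form_mhom C _ N k _).
  move=> hL; apply: mhom_ext _ (mhomM (@linear_form_mhom C _ N k _) hL) => l.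
  rewrite -big_mkcondr sum1dep_card /=; have [->|ne_l] := eqVneq l k.
    by rewrite eq_card0 // => i; rewrite !inE; case: eqP => //= neq; apply/eqP => /esym.
  rewrite (eq_card (B := pred1 l)) ?card1 // => i; rewrite !inE (eq_sym l).
  by case: (eqVneq i l) => [->|]; rewrite ?ne_l ?andbF.
rewrite mevalM entry_polyE rmorph_prod /= expr1 [in RHS](bigD1 k) //= mulrACA mulVf // mul1r.
by congr (_ * _); apply: eq_bigr => l _; apply: entry_polyE.
Qed.

(** An extra factor [lead_poly] makes the numerator vanish also at the nondegenerate quadrics
    outside the chart, so that the definition of the closure applies. *)
Lemma chart_regular_vanish f v : chart_regular f ->
  (forall A, A^T = A -> A \in unitmx -> forall w, (forall k, lam w k != 0) ->
     (forall k, exists c, w k = c *: ext_pow k.+1 A) -> f w = 0) ->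
  zariski_closure (nondeg_quadrics C n) (point_of v) -> (forall k, lam v k != 0) -> f v = 0.
Proof.
move=> [m [p [hp pE]]] f0 [_ closv] nzv.
have : (p * lead_poly).@[@coords C _ N v] = 0.
  apply: closv => //; first exact: mhom_multihomogeneous (mhomM hp lead_poly_mhom).
  move=> _ [A [sA uA ->]] w spanw; rewrite mevalM lead_polyE.
  have [nzw|] := boolP [forall k, lam w k != 0].
    move/forallP in nzw; rewrite pE // (f0 A) ?mul0r // => k.
    by apply/vlineP; have := spanw k; rewrite /ext_lines => ->; apply: memv_line.
  by case/forallPn => k /negPn/eqP lam0; rewrite (bigD1 k) //= lam0 mul0r mulr0.
rewrite mevalM lead_polyE pE // => /eqP; rewrite -mulrA -exprSr mulf_eq0 expf_eq0 /=.
by case/orP => [/eqP//|/prodf_eq0[k _]]; rewrite (negPf (nzv k)).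
Qed.

Definition normalized w : family := fun k => (lam w k)^-1 *: cong_fam g w k.

(** For a nondegenerate quadric, given in the frame [g] by A = U^T D U, this is U, read off the
    leading rows at the hooks. As [i < j] puts [i] below [n.-1], the default of [oapp] is never
    reached. *)
Definition unipotent_of w : 'M[C]_n := \matrix_(i, j)
  if i == j then 1 else if (i < j)%N
  then oapp (fun k => normalized w k (lead k) (hook k j)) 0 (insub (i : nat)) else 0.

(** The determinant being 1, the adjugate is the inverse, in polynomial form. *)
Definition diagonalized w : family := cong_fam (\adj (unipotent_of w)) (normalized w).

(** For A = U^T D U, the quotient of the entries [k.+1] and [k] of D. *)
Definition ratio w k := diagonalized w k (hook k (pos_succ k)) (hook k (pos_succ k)).

Lemma unipotent_of_upper w : upper_mx (unipotent_of w).
Proof. by move=> i j lt_ji; rewrite mxE -val_eqE gtn_eqF // ltnNge ltnW. Qed.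

Lemma unipotent_of_diag w i : unipotent_of w i i = 1.
Proof. by rewrite mxE eqxx. Qed.

Lemma det_unipotent_of w : \det (unipotent_of w) = 1.
Proof.
rewrite det_upper; last exact: unipotent_of_upper.
by apply: big1 => i _; apply: unipotent_of_diag.
Qed.

Let CR := chart_regular_ring.

Lemma normalized_regular k a b : chart_regular (fun w => normalized w k a b).
Proof.
by apply: fring_eq (chart_regular_entry a b) => w; rewrite [LHS]mxE.
Qed.

Lemma unipotent_of_regular i j : chart_regular (fun w => unipotent_of w i j).
Proof.
apply: (@fring_eq _ _ _ _ (fun w => if i == j then 1 else if (i < j)%N
  then oapp (fun k => normalized w k (lead k) (hook k j)) 0 (insub (i : nat)) else 0)).
  by move=> w; rewrite mxE.
case: (i == j); first exact: (fring_cst CR).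
case: (i < j)%N; last exact: (fring_cst CR).
by case: insubP => [k _ _|_] /=; [apply: normalized_regular | apply: (fring_cst CR)].
Qed.

Lemma diagonalized_regular k a b : chart_regular (fun w => diagonalized w k a b).
Proof.
have adj_reg i j : chart_regular (fun w => \adj (unipotent_of w) i j).
  by apply: (fring_adj CR); apply: unipotent_of_regular.
apply: (fring_mulmx CR); last by apply: (fring_ext_pow CR).
apply: (fring_mulmx CR); last exact: normalized_regular.
by apply: fring_tr; apply: (fring_ext_pow CR).
Qed.

Lemma diagonalized_nondeg A : A^T = A -> A \in unitmx -> forall w, (forall k, lam w k != 0) ->
  (forall k, exists c, w k = c *: ext_pow k.+1 A) ->
  exists2 d : 'I_n -> C, forall i, d i != 0 & forall k a b,
    diagonalized w k a b =
    (a == b)%:R * \prod_(i < k.+1) (d (basis_incr a i) / d (basis_incr (lead k) i)).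
Proof.
move=> sA uA w nzw wA; pose A1 := g^T *m A *m g.
have sA1 : A1^T = A1 by rewrite !trmx_mul trmxK sA mulmxA.
have uA1 : A1 \in unitmx by rewrite !unitmx_mul unitmx_tr ug uA.
have cwA k : exists2 c, c != 0 & cong_fam g w k = c *: ext_pow k.+1 A1.
  have [c wk] := wA k; exists c.
    apply: contraNneq (nzw k) => c0.
    by rewrite /lead_coef_of /cong_fam wk c0 scale0r mulmx0 mul0mx mxE.
  by rewrite /cong_fam wk !ext_powM ext_pow_tr -scalemxAr -scalemxAl.
have nzA1 k : ext_pow k.+1 A1 (lead k) (lead k) != 0.
  have [c nzc wk] := cwA k; have := nzw k; rewrite /lead_coef_of wk [X in X != 0]mxE.
  by rewrite mulf_eq0 (negPf nzc).
have [u [d [upu u1 nzd defA1]]] := LDL_decomposition sA1 uA1 nzA1.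
exists (d 0) => // k.
have nzdl (l : 'I_n.-1) : \prod_(i < l.+1) d 0 (basis_incr (lead l) i) != 0 by apply/prodf_neq0.
have A1E l : ext_pow l.+1 A1 = (ext_pow l.+1 u)^T *m ext_pow l.+1 (diag_mx d) *m ext_pow l.+1 u.
  by rewrite defA1 !ext_powM ext_pow_tr.
have A1lead (l : 'I_n.-1) b : ext_pow l.+1 A1 (lead l) b =
    (\prod_(i < l.+1) d 0 (basis_incr (lead l) i)) * ext_pow l.+1 u (lead l) b.
  rewrite A1E -mulmxA [LHS]mxE (bigD1 (lead l)) //= [X in _ + X]big1 ?addr0 => [|a ne_a].
    rewrite [_^T _ _]mxE ext_pow_unipotent_lead // mul1r ext_pow_diag mul_diag_mx [LHS]mxE.
    by rewrite [X in X * _]mxE.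
  by rewrite [_^T _ _]mxE ext_pow_lead // mul0r.
have nrmE (l : 'I_n.-1) : normalized w l =
    (\prod_(i < l.+1) d 0 (basis_incr (lead l) i))^-1 *: ext_pow l.+1 A1.
  have [c nzc wl] := cwA l; rewrite /normalized /lead_coef_of wl [X in X^-1]mxE scalerA.
  congr (_ *: _); rewrite A1lead ext_pow_unipotent_lead // mulr1 invfM mulrAC mulVf //.
  by rewrite mul1r.
have Uu : unipotent_of w = u.
  apply/matrixP => i j; rewrite mxE; case: eqVneq => [->|neq_ij]; first by rewrite u1.
  case: ltnP => [lt_ij|le_ji]; last first.
    by rewrite upu // ltn_neqAle le_ji andbT eq_sym.
  case: insubP => [l _ def_l|]; last by have := ltn_ord j; lia.
  rewrite /= nrmE [LHS]mxE A1lead mulKf // ext_pow_unipotent_hook //; last by rewrite def_l ltnW.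
  by congr (u _ _); apply: val_inj.
have uV : u *m \adj u = 1%:M by rewrite mul_mx_adj -Uu det_unipotent_of.
move=> a b; rewrite /diagonalized Uu /cong_fam nrmE A1E -scalemxAr -scalemxAl [LHS]mxE.
rewrite !mulmxA -trmx_mul -ext_powM uV ext_pow1 trmx1 mul1mx -mulmxA -ext_powM uV ext_pow1 mulmx1.
rewrite ext_pow_diag !mxE; case: eqVneq => _; last by rewrite mulr0n mulr0 mul0r.
by rewrite mulr1n mul1r mulrC big_split /= prodfV.
Qed.

Lemma ratio_nondeg w (d : 'I_n -> C) : (forall i, d i != 0) ->
  (forall k a b, diagonalized w k a b =
     (a == b)%:R * \prod_(i < k.+1) (d (basis_incr a i) / d (basis_incr (lead k) i))) ->
  forall k, ratio w k = d (pos_succ k) / d (pos k).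
Proof.
move=> nzd dE k; rewrite /ratio dE eqxx mul1r big_ord_recr /= big1 ?mul1r => [|i _].
  congr (d _ / d _); apply: val_inj => /=; last by rewrite leadE.
  by rewrite hookE ltnn; apply/maxn_idPr => /=.
rewrite (_ : basis_incr (hook _ _) _ = basis_incr (lead k) (widen_ord (leqnSn k) i)) ?mulfV //.
by apply: val_inj; rewrite /= hookE leadE /= ltn_ord.
Qed.

(** On nondegenerate quadrics the diagonal entries are products of quotients d_y / d_x with x <= y.
    Written through consecutive ratios these have no denominators, so the identity is one between
    regular functions and extends to the closure. *)
Lemma diagonalized_closure v : zariski_closure (nondeg_quadrics C n) (point_of v) ->
  (forall k, lam v k != 0) -> forall k a b, diagonalized v k a b =
  (a == b)%:R * \prod_(i < k.+1) \prod_(j < n.-1 | (i <= j < basis_incr a i)%N) ratio v j.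
Proof.
move=> closv nzv k a b; apply/eqP; rewrite -subr_eq0; apply/eqP.
pose f w := diagonalized w k a b -
  (a == b)%:R * \prod_(i < k.+1) \prod_(j < n.-1 | (i <= j < basis_incr a i)%N) ratio w j.
apply: (@chart_regular_vanish f v) => //.
  apply: (fring_add CR); first exact: diagonalized_regular.
  apply: (fring_opp CR); apply: (fring_mul CR); first exact: (fring_cst CR).
  by apply: (fring_prod CR) => i _; apply: (fring_prod CR) => j _; apply: diagonalized_regular.
move=> A sA uA w nzw wA; have [d nzd dE] := diagonalized_nondeg sA uA nzw wA.
rewrite /f dE; apply/eqP; rewrite subr_eq0; apply/eqP; congr (_ * _); apply: eq_bigr => i _.
under eq_bigr => j _ do rewrite (ratio_nondeg nzd dE).
have le_i : (basis_incr (lead k) i <= basis_incr a i)%N by rewrite leadE leq_basis_incr.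
rewrite (telescope_prod nzd le_i) mulrC mulKf //.
by apply: eq_bigl => j; rewrite leadE.
Qed.

Lemma diagonalized_lim v : zariski_closure (nondeg_quadrics C n) (point_of v) ->
  (forall k, lam v k != 0) -> forall k, exists2 c, c != 0 &
  diagonalized v k =
  c *: lim_fam (zeros_before (ratio v)) (diag_mx (\row_i partial_prod (ratio v) i)) k.
Proof.
move=> closv nzv k; pose be := zeros_before (ratio v); pose de := partial_prod (ratio v).
pose c0 := \prod_(i < k.+1) de (basis_incr (lead k) i).
have nzc : c0 != 0 by apply/prodf_neq0 => i _; apply: partial_prod_neq0.
exists c0^-1; first by rewrite invr_eq0.
have le_w (a : 'I_(ext_dim k.+1 n)) i : (be (basis_incr (lead k) i) <= be (basis_incr a i))%N.
  by apply: leq_marks_before; rewrite leadE leq_basis_incr.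
(* [lead k] has the lowest levels element by element, so the subsets of minimal weight match it
   level by level; these are the ones whose product of ratios meets no zero. *)
have minE (a : 'I_(ext_dim k.+1 n)) :
    min_weight be a = [forall i, be (basis_incr (lead k) i) == be (basis_incr a i)].
  apply/forallP/forallP => [min_a i|eq_a b].
    rewrite eqn_leq le_w /= leqNgt; apply: contraL (min_a (lead k)) => lt_i.
    rewrite -ltnNge /weight (bigD1 i) //= [X in (_ < X)%N](bigD1 i) //= -addSn leq_add //.
    by apply: leq_sum => l _; apply: le_w.
  by apply: leq_sum => i _; rewrite -(eqP (eq_a i)) le_w.
apply/matrixP => a b; rewrite diagonalized_closure // [RHS]mxE lim_extE ext_pow_diag.
rewrite [diag_mx _ a b]mxE; case: (eqVneq a b) => [<-|_] /=; last first.
  by rewrite mulr0n if_same mulr0 mul0r.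
rewrite mul1r mulr1n andbb mxE minE.
under eq_bigr => i _.
  rewrite (eq_bigl (fun j : 'I_n.-1 => basis_incr (lead k) i <= j < basis_incr a i)%N);
    last by move=> j; rewrite leadE.
  rewrite prod_between; last by rewrite leadE leq_basis_incr.
  over.
rewrite big_split /= [X in _ * X]big_split /= prodfV -/c0 -/be -/de.
case: forallP => [eq_a|].
  rewrite big1 => [|i _]; last by rewrite (eqP (eq_a i)) eqxx.
  by rewrite mul1r mulrC; congr (_ * _); apply: eq_bigr => i _; rewrite mxE.
move=> neq_a; rewrite mulr0.
have /forallPn[i ne_i] : ~~ [forall i, be (basis_incr (lead k) i) == be (basis_incr a i)].
  by apply/negP => /forallP.
by rewrite (bigD1 i) //= (negPf ne_i) !mul0r.
Qed.

End Chart.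

Lemma closure_chart (C : numClosedFieldType) (n : nat)
    (v : forall k : 'I_n.-1, 'M[C]_(ext_dim k.+1 n)) :
  zariski_closure (nondeg_quadrics C n) (point_of v) -> (forall k, v k != 0) ->
  exists h : 'M[C]_n, exists be : 'I_n -> nat, exists d : 'rV[C]_n,
  [/\ h \in unitmx, forall x y : 'I_n, (x <= y)%N -> (be x <= be y)%N, initial_image be,
      diag_mx d \in unitmx & point_of v = point_of (cong_fam h (lim_fam be (diag_mx d)))].
Proof.
move=> closv nzv; have [g ug nzlam] := generic_frame closv nzv.
pose be := zeros_before (ratio g v); pose d := \row_i partial_prod (ratio g v) i.
pose U := unipotent_of g v.
have uU : U \in unitmx by rewrite unitmxE det_unipotent_of unitr1.
exists (U *m invmx g), be, d; split.
- by rewrite unitmx_mul uU unitmx_inv.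
- exact: leq_marks_before.
- exact: marks_before_initial.
- apply: upper_unitP => [|i]; first exact: upper_mx_diag.
  by rewrite !mxE eqxx mulr1n partial_prod_neq0.
have vE : v = cong_fam (invmx g) (fun k => lead_coef_of g v k *: cong_fam U (diagonalized g v) k).
  rewrite /diagonalized cong_famM mul_adj_mx det_unipotent_of cong_fam1.
  rewrite (_ : (fun k => _) = cong_fam g v) ?cong_famM ?mulmxV ?cong_fam1 //.
  by apply: functional_extensionality_dep => k; rewrite scalerA mulfV // scale1r.
have ex_c k : exists c, c != 0 /\ diagonalized g v k = c *: lim_fam be (diag_mx d) k.
  by have [c] := diagonalized_lim ug closv nzlam k; exists c.
have [c cP] := boolp.choice ex_c.
have dE : diagonalized g v = (fun k => c k *: lim_fam be (diag_mx d) k).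
  by apply: functional_extensionality_dep => k; rewrite (cP k).2.
rewrite [in LHS]vE cong_fam_scale point_of_scale // dE !cong_fam_scale point_of_scale ?cong_famM //.
by move=> k; apply: (cP k).1.
Qed.

(** * Minimal coset representatives for J without consecutive elements *)

Section CosetRepresentatives.

Variable n : nat.
Local Open Scope nat_scope.
Implicit Types (i j : 'I_n.-1) (J S : {set 'I_n.-1}) (w u : 'S_n) (p q x y : 'I_n).

Lemma no_consecutiveP J i j : no_consecutive J -> i \in J -> j \in J -> (j : nat) != i.+1.
Proof. by move=> /forall_inP/(_ i)h iJ; have /forall_inP := h iJ; apply. Qed.

Lemma ex_pos p q : p < q -> exists2 j : 'I_n.-1, pos j = p & j = p :> nat.
Proof.
move=> lt_pq; have lt_p : p < n.-1 by have := ltn_ord q; lia.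
by exists (Ordinal lt_p) => //; apply: val_inj.
Qed.

Lemma parabolic_block J u p : u \in parabolic J ->
  marks_before (fun i => i \notin J) (u p) = marks_before (fun i => i \notin J) p.
Proof.
pose bl := marks_before (fun i => i \notin J).
pose H := [set u : 'S_n | [forall p, bl (u p) == bl p]]%SET.
have gH : group_set H.
  apply/group_setP; split=> [|u1 u2]; first by rewrite inE; apply/forallP => x; rewrite perm1.
  rewrite !inE => /forallP h1 /forallP h2; apply/forallP => x.
  by rewrite permM (eqP (h2 _)) h1.
have sub : parabolic J \subset Group gH.
  rewrite gen_subG; apply/fintype.subsetP => _ /imsetP[j jJ ->]; rewrite inE.
  have eq_bl : bl (pos_succ j) = bl (pos j) by rewrite /bl marks_before_pos_succ jJ addn0.
  by apply/forallP => x; rewrite /simple_transp; case: tpermP => [->|->|_ _]; rewrite ?eq_bl.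
by move=> /(fintype.subsetP sub); rewrite inE => /forallP/(_ p)/eqP.
Qed.

(** Order can be reversed only inside a block of positions joined by [J], and such a block has at
    most two elements. *)
Lemma parabolic_mono J u p q : no_consecutive J -> u \in parabolic J -> p < q ->
  u p < u q \/ exists2 j, j \in J & p = pos j /\ q = pos_succ j.
Proof.
move=> ncJ uJ lt_pq; pose bl := marks_before (fun i => i \notin J).
have bu x : bl (u x) = bl x by apply: parabolic_block.
case: (ltnP (u p) (u q)) => [|le_qp]; [by left | right].
have : bl q <= bl p by rewrite -(bu p) -(bu q); apply: leq_marks_before.
rewrite {1}/bl (marks_before_split _ (ltnW lt_pq)) -[X in _ <= X]addn0 leq_add2l leqn0.
rewrite sum_nat_eq0 => /forallP inJ.
have [j def_p val_j] := ex_pos lt_pq.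
have jJ : j \in J.
  by have /implyP := inJ j; rewrite val_j leqnn lt_pq => /(_ isT); case: (j \in J).
exists j => //; split=> //; apply: val_inj => /=; apply/eqP; rewrite eqn_leq andbC.
rewrite val_j lt_pq /= leqNgt; apply/negP => lt_q.
have lt_j1 : j.+1 < n.-1 by have := ltn_ord q; lia.
have /implyP h := inJ (Ordinal lt_j1); have {}/h : p <= Ordinal lt_j1 < q by move=> /=; lia.
case j1J : (_ \in J) => // _.
by have := no_consecutiveP ncJ jJ j1J; rewrite /= eqxx.
Qed.

Lemma simple_transpE j x : simple_transp j x =
  (if x == j :> nat then j.+1 else if x == j.+1 :> nat then j : nat else x) :> nat.
Proof.
rewrite /simple_transp; case: tpermP => [->|->|ne1 ne2] /=; rewrite ?eqxx //.
  by rewrite gtn_eqF.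
by case: eqP => [e1|_]; [case: ne1; apply: val_inj | case: eqP => [e2|//]; case: ne2; apply: val_inj].
Qed.

(** If [w] descends at some [j] in [J], the transposition injects the inversions of the product into
    those of [w] other than this descent. Conversely, if [w] increases at [J], the inverse of [u]
    reverses only pairs that are not inversions of [w], so the inversions of [w] inject into those
    of [u * w]. *)
Lemma min_coset_repsP J w : no_consecutive J ->
  reflect (forall j, j \in J -> w (pos j) < w (pos_succ j)) (w \in min_coset_reps J).
Proof.
move=> ncJ; rewrite inE; apply: (iffP forall_inP) => [minw j jJ|incr u uJ].
  rewrite ltnNge leq_eqVlt; apply/negP => /orP[/eqP/val_inj/perm_inj/(congr1 val)/=|desc].
    by lia.
  have uJ : simple_transp j \in parabolic J by apply: mem_gen; apply: imset_f.
  have := minw _ uJ; rewrite leqNgt => /negP; apply.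
  rewrite /perm_length [X in _ < X](cardsD1 (pos j, pos_succ j)) inE /= ltnSn desc add1n ltnS.
  set u := simple_transp j.
  have f_inj : injective (fun r : 'I_n * 'I_n => (u r.1, u r.2)).
    by move=> [p1 q1] [p2 q2] /= [/perm_inj-> /perm_inj->].
  rewrite -(card_imset _ f_inj).
  apply: subset_leq_card; apply/fintype.subsetP => r /imsetP[[p q]].
  rewrite !inE /= !permM => /andP[lt_pq inv] ->; rewrite /= inv andbT xpair_eqE.
  have not_j : ~ (p = pos j /\ q = pos_succ j).
    by move=> [def_p def_q]; move: inv; rewrite def_p def_q tpermL tpermR ltnNge ltnW.
  have {}not_j : ~ (p = j :> nat /\ q = j.+1 :> nat).
    by move=> [def_p def_q]; apply: not_j; split; apply: val_inj.
  rewrite -!val_eqE /= !simple_transpE; move: lt_pq; do !case: eqP => //=; lia.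
have f_inj : injective (fun r : 'I_n * 'I_n => (u^-1%g r.1, u^-1%g r.2)).
  by move=> [p1 q1] [p2 q2] /= [/perm_inj-> /perm_inj->].
rewrite /perm_length -(card_imset _ f_inj).
apply: subset_leq_card; apply/fintype.subsetP => r /imsetP[[p q]].
rewrite !inE /= => /andP[lt_pq inv] ->; rewrite /= !permM !permKV inv andbT.
case: (parabolic_mono ncJ (groupVr uJ) lt_pq) => // -[j jJ [def_p def_q]].
by have := incr j jJ; rewrite -def_p -def_q ltnNge ltnW.
Qed.

End CosetRepresentatives.

(** * Ordered partitions with an involution as marked coset representatives *)

Section SortedData.

Variable n : nat.
Local Open Scope nat_scope.
Implicit Types (i j : 'I_n.-1) (J S : {set 'I_n.-1}) (w s : 'S_n) (x y : 'I_n).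
Implicit Types (be : 'I_n -> nat).

(* Splitting w at the positions outside J gives a sequence of blocks of size 1 or 2;
   these are the positions at which the block minima descend. *)
Definition doubling_set J w : {set 'I_n.-1} :=
  [set i | [&& descent w i, i \notin J &
     ~~ pred_in J i || [exists j in J, [&& j.+1 == i :> nat,
        w (pos_succ i) < w (pos j) & w (pos j) < w (pos i)]]]]%SET.

Lemma card_doubling_set J w : #|doubling_set J w| = a_stat J w + b_stat J w.
Proof.
rewrite /a_stat /b_stat -cardsUI [X in _ + X](_ : _ = 0) ?addn0; last first.
  apply/eqP; rewrite cards_eq0; apply/eqP/setP => i; rewrite !inE.
  apply/negbTE/negP => /andP[/and3P[_ _ /negP np] /and3P[_ _ /exists_inP[j jJ /andP[eq_j _]]]].
  by apply: np; apply/exists_inP; exists j.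
by apply: eq_card => i; rewrite !inE -andb_orr -andb_orr.
Qed.

Definition marked_reps : {set {set 'I_n.-1} * 'S_n * {set 'I_n.-1}} :=
  [set t : {set 'I_n.-1} * 'S_n * {set 'I_n.-1} |
     [&& no_consecutive t.1.1, t.1.2 \in min_coset_reps t.1.1 &
             t.2 \subset doubling_set t.1.1 t.1.2]]%SET.

Lemma card_marked_reps : #|marked_reps| =
  \sum_(J : {set 'I_n.-1} | no_consecutive J)
    \sum_(w in min_coset_reps J) 2 ^ (a_stat J w + b_stat J w).
Proof.
under eq_bigr => J _ do under eq_bigr => w _ do
  rewrite -card_doubling_set -card_powerset -sum1_card.
rewrite pair_big_dep pair_big_dep -sum1_card; apply: eq_bigl => -[[J w] S] /=.
by rewrite !inE /= -andbA.
Qed.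

Definition partner J x : 'I_n :=
  if [pick j in J | pos j == x] is Some j then pos_succ j
  else if [pick j in J | pos_succ j == x] is Some j then pos j else x.

Lemma pos_inj : injective (@pos n).
Proof. by move=> i j /(congr1 val) /= /val_inj. Qed.

Lemma pos_succ_inj : injective (@pos_succ n).
Proof. by move=> i j /(congr1 val) /= [/val_inj]. Qed.

Lemma partner_pos J j : j \in J -> partner J (pos j) = pos_succ j.
Proof.
move=> jJ; rewrite /partner; case: pickP => [i /andP[_ /eqP/pos_inj->]//|/(_ j)].
by rewrite jJ eqxx.
Qed.

Lemma partner_pos_succ J j : no_consecutive J -> j \in J -> partner J (pos_succ j) = pos j.
Proof.
move=> ncJ jJ; rewrite /partner; case: pickP => [i /andP[iJ /eqP/(congr1 val)/= eq_i]|_].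
  by have := no_consecutiveP ncJ jJ iJ; rewrite eq_i eqxx.
case: pickP => [i /andP[_ /eqP/pos_succ_inj->]//|/(_ j)].
by rewrite jJ eqxx.
Qed.

Variant partner_spec J x : 'I_n -> Prop :=
| PartnerSucc j of j \in J & x = pos j : partner_spec J x (pos_succ j)
| PartnerPred j of j \in J & x = pos_succ j : partner_spec J x (pos j)
| PartnerId of (forall j, j \in J -> pos j != x) & (forall j, j \in J -> pos_succ j != x) :
    partner_spec J x x.

Lemma partnerP J x : partner_spec J x (partner J x).
Proof.
rewrite /partner; case: pickP => [i /andP[iJ /eqP eq_i]|no1]; first exact: PartnerSucc.
case: pickP => [i /andP[iJ /eqP eq_i]|no2]; first exact: PartnerPred.
by apply: PartnerId => j jJ; apply: negbT; [have := no1 j | have := no2 j]; rewrite jJ.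
Qed.

Lemma partnerK J : no_consecutive J -> involutive (partner J).
Proof.
move=> ncJ x; case: (partnerP J x) => [j jJ ->|j jJ ->|no1 no2].
- exact: partner_pos_succ.
- exact: partner_pos.
by case: (partnerP J x) => // j jJ eq_x; [have := no1 j jJ | have := no2 j jJ]; rewrite eq_x eqxx.
Qed.

(** The word of [w] is cut after each position outside [J] and [S]; a position of [S] outside [J]
    joins two consecutive cycles in one block. *)
Definition level_of J w S x :=
  marks_before (fun i => i \notin (J :|: S)%SET) (w^-1%g x).

Definition involution_fun J w x := w (partner J (w^-1%g x)).

Lemma involution_funK J w : no_consecutive J -> involutive (involution_fun J w).
Proof. by move=> ncJ x; rewrite /involution_fun permK partnerK // permKV. Qed.

(* Junk value 1 when [J] has consecutive elements. *)
Definition involution_of J w : 'S_n :=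
  odflt 1%g [pick s : 'S_n | [forall x, s x == involution_fun J w x]].

Lemma involution_ofE J w x : no_consecutive J -> involution_of J w x = w (partner J (w^-1%g x)).
Proof.
move=> ncJ; rewrite /involution_of; case: pickP => [s /forallP/(_ x)/eqP->//|].
move=> /(_ (perm (inv_inj (involution_funK w ncJ))))/forallP[] y.
by rewrite permE.
Qed.

Lemma involution_ofK J w x : no_consecutive J -> involution_of J w (involution_of J w x) = x.
Proof. by move=> ncJ; rewrite !involution_ofE // permK partnerK // permKV. Qed.

Lemma level_of_pos_succ J w S j : level_of J w S (w (pos_succ j)) =
  level_of J w S (w (pos j)) + (j \notin (J :|: S)%SET).
Proof. by rewrite /level_of !permK marks_before_pos_succ. Qed.

Lemma level_of_involution J w S x : no_consecutive J ->
  level_of J w S (involution_of J w x) = level_of J w S x.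
Proof.
move=> ncJ; rewrite involution_ofE // -[in RHS](permKV w x).
have eqJ j : j \in J -> level_of J w S (w (pos_succ j)) = level_of J w S (w (pos j)).
  by move=> jJ; rewrite level_of_pos_succ !inE jJ addn0.
by case: partnerP => [j jJ ->|j jJ ->|//]; rewrite eqJ.
Qed.

Lemma level_of_initial J w S : initial_image (level_of J w S).
Proof.
move=> x c /(marks_before_initial)[y eq_y]; exists (w y).
by rewrite /level_of permK.
Qed.

Definition cycle_min s x := minn x (s x).

(* Blocks of the ordered set partition in increasing order, cycles of the involution
   inside a block by decreasing minima: sorting by this order inverts
   [level_of] and [involution_of]. *)
Definition cycle_lt be s x y :=
  (be x < be y) || ((be x == be y) &&
    ((cycle_min s y < cycle_min s x) || ((cycle_min s x == cycle_min s y) && (x < y)))).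

Lemma cycle_lt_irr be s : irreflexive (cycle_lt be s).
Proof. by move=> x; rewrite /cycle_lt; lia. Qed.

Lemma cycle_lt_trans be s : transitive (cycle_lt be s).
Proof. by move=> y x z; rewrite /cycle_lt; lia. Qed.

Lemma cycle_lt_total be s x y : x != y -> cycle_lt be s x y || cycle_lt be s y x.
Proof. by rewrite -val_eqE /cycle_lt /=; lia. Qed.

Lemma cycle_min_invol s x : (forall z, s (s z) = z) -> cycle_min s (s x) = cycle_min s x.
Proof. by move=> sK; rewrite /cycle_min sK minnC. Qed.

Lemma cycle_min_eq s x y : (forall z, s (s z) = z) -> cycle_min s x = cycle_min s y ->
  y = x \/ y = s x.
Proof.
move=> sK; rewrite /cycle_min => eq_m.
have : [|| y == x :> nat, y == s x :> nat, s y == x :> nat | s y == s x :> nat] by lia.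
case/or4P => /eqP/val_inj; [by left | by right | | ].
  by move=> <-; right.
by move=> /perm_inj; left.
Qed.

Definition cycle_sorted be s w := forall j, cycle_lt be s (w (pos j)) (w (pos_succ j)).

Lemma cycle_sorted_lt be s w : cycle_sorted be s w ->
  forall x y, x < y -> cycle_lt be s (w x) (w y).
Proof.
move=> sorted_w x [y lt_yn] /=; elim: y lt_yn => // y IHy lt_yn; rewrite ltnS => le_xy.
have lt_y : y < n.-1 by lia.
have step := sorted_w (Ordinal lt_y).
rewrite (_ : pos_succ _ = Ordinal lt_yn) in step; last exact: val_inj.
rewrite (_ : pos _ = Ordinal (ltnW lt_yn)) in step; last exact: val_inj.
have [eq_x|ne_x] := eqVneq (x : nat) y.
  by rewrite (_ : x = Ordinal (ltnW lt_yn)) //; apply: val_inj.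
by apply: cycle_lt_trans step; apply: IHy; lia.
Qed.

Lemma cycle_sorted_mono be s w : cycle_sorted be s w ->
  forall x y, cycle_lt be s (w x) (w y) = (x < y).
Proof.
move=> /cycle_sorted_lt sorted_w x y; apply/idP/idP => [lt_w|/sorted_w//].
case: (ltngtP x y) => // [/sorted_w lt_w'|/val_inj eq_xy].
  by have := cycle_lt_trans lt_w lt_w'; rewrite cycle_lt_irr.
by rewrite eq_xy cycle_lt_irr in lt_w.
Qed.

Lemma cycle_sorted_unique be s w w' : cycle_sorted be s w -> cycle_sorted be s w' -> w = w'.
Proof.
move=> sw sw'; have /perm_incr_id eq1 : forall x y, x < y -> (w * w'^-1)%g x < (w * w'^-1)%g y.
  by move=> x y lt_xy; rewrite !permM -(cycle_sorted_mono sw') !permKV (cycle_sorted_mono sw).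
by rewrite -[w]mulg1 -(mulVg w') mulgA eq1 mul1g.
Qed.

(** Makes [J], [w] and [S] functions of [be] and [s]: sorting gives [w], then adjacent partners give
    [J] and equal levels give [S]. *)
Definition sorted_data J w S be s :=
  [/\ forall j, (j \in J) = (s (w (pos j)) == w (pos_succ j)),
      forall j, (j \in S) = (j \notin J) && (be (w (pos j)) == be (w (pos_succ j)))
    & cycle_sorted be s w].

Lemma sorted_data_unique J w S J' w' S' be s :
  sorted_data J w S be s -> sorted_data J' w' S' be s -> (J, w, S) = (J', w', S').
Proof.
move=> [J1 S1 sw] [J2 S2 sw']; have eq_w := cycle_sorted_unique sw sw'; rewrite -eq_w in J2 S2 *.
have eq_J : J = J' by apply/setP => j; rewrite J1 J2.
have eq_S : S = S' by apply/setP => j; rewrite S1 S2 eq_J.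
by rewrite eq_J eq_S.
Qed.

(** At a position of [J] a 2-cycle is read in increasing order; outside [J] and [S] the level grows;
    at a position of [S] the condition in [doubling_set] puts the next entry below the whole cycle
    before it. *)
Lemma marked_reps_sorted J w S : (J, w, S) \in marked_reps ->
  sorted_data J w S (level_of J w S) (involution_of J w).
Proof.
rewrite inE /= => /and3P[ncJ /(min_coset_repsP _ ncJ) incr subS].
have sE x : involution_of J w (w x) = w (partner J x) by rewrite involution_ofE // permK.
have SnJ j : j \in S -> j \notin J.
  by move=> /(fintype.subsetP subS); rewrite inE => /and3P[].
split=> j.
- rewrite sE (inj_eq (@perm_inj _ w)); apply/idP/eqP => [/partner_pos//|].
  case: partnerP => [i iJ /pos_inj->//|i iJ|no1 no2] /(congr1 val) /=; last by lia.
  by move=> e1 /(congr1 val) /=; lia.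
- rewrite level_of_pos_succ !inE -[X in X == _]addn0 eqn_add2l eq_sym.
  by case: (boolP (j \in S)) => [/SnJ->|]; rewrite ?orbT ?orbF //; case: (j \in J).
have lvl := level_of_pos_succ J w S j; move: lvl; rewrite !inE.
case jJ : (j \in J) => /= lvl.
  rewrite addn0 in lvl; rewrite /cycle_lt lvl ltnn eqxx /= /cycle_min !sE partner_pos // partner_pos_succ //.
  by have := incr j jJ; lia.
move: lvl; case jS : (j \in S) => /= lvl; last by rewrite /cycle_lt lvl addn1 ltnSn.
rewrite /cycle_lt lvl addn0 ltnn eqxx /=.
have := fintype.subsetP subS j jS; rewrite inE => /and3P[desc _ cond].
suff : cycle_min (involution_of J w) (w (pos_succ j)) <
    cycle_min (involution_of J w) (w (pos j)) by lia.
apply: (@leq_ltn_trans (w (pos_succ j))); first exact: geq_minl.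
rewrite /descent in desc; rewrite /cycle_min leq_min desc /= sE.
case: partnerP => [i iJ /pos_inj eq_i|i iJ eq_i|//]; first by rewrite -eq_i jJ in iJ.
have val_i : j = i.+1 :> nat by have /(congr1 val) := eq_i.
case/orP: cond => [/negP[]|/exists_inP[i' i'J /and3P[/eqP val_i' lt1 _]]].
  by apply/exists_inP; exists i => //; apply/eqP.
by rewrite (_ : i = i') //; apply: val_inj => /=; lia.
Qed.

Lemma marked_reps_inj J w S J' w' S' : (J, w, S) \in marked_reps -> (J', w', S') \in marked_reps ->
  level_of J w S =1 level_of J' w' S' -> involution_of J w = involution_of J' w' ->
  (J, w, S) = (J', w', S').
Proof.
move=> /marked_reps_sorted sd /marked_reps_sorted sd' /boolp.funext eq_l eq_i.
by rewrite eq_l eq_i in sd; apply: sorted_data_unique sd sd'.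
Qed.

Lemma marked_reps_ex be s : initial_image be -> (forall x, s (s x) = x) ->
  (forall x, be (s x) = be x) -> exists J w S,
  [/\ (J, w, S) \in marked_reps, level_of J w S =1 be & involution_of J w = s].
Proof.
move=> init sK bes.
have [r rP] := rank_perm (cycle_lt_irr be s) (@cycle_lt_trans be s) (@cycle_lt_total be s).
pose w := (r^-1)%g.
have sw : forall x y, cycle_lt be s (w x) (w y) = (x < y).
  by move=> x y; rewrite -rP !permKV.
have wr x : w (r x) = x by rewrite permK.
pose J := [set j | s (w (pos j)) == w (pos_succ j)]%SET.
pose S := [set j | (j \notin J) && (be (w (pos j)) == be (w (pos_succ j)))]%SET.
have JE j : (j \in J) = (s (w (pos j)) == w (pos_succ j)) by rewrite inE.
have SE j : (j \in S) = (j \notin J) && (be (w (pos j)) == be (w (pos_succ j))) by rewrite inE.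
have step j : cycle_lt be s (w (pos j)) (w (pos_succ j)) by rewrite sw.
have ncJ : no_consecutive J.
  apply/forall_inP => i; rewrite JE => /eqP iJ; apply/forall_inP => j; rewrite JE => /eqP jJ.
  apply/eqP => val_j; have eq_p : pos_succ i = pos j by apply: val_inj.
  have : w (pos_succ j) = w (pos i) by rewrite -jJ -eq_p -iJ sK.
  by move=> /perm_inj/(congr1 val) /=; lia.
have Jbe j : j \in J -> be (w (pos j)) = be (w (pos_succ j)).
  by rewrite JE => /eqP <-; rewrite bes.
have Jmin j : j \in J -> cycle_min s (w (pos j)) = cycle_min s (w (pos_succ j)).
  by rewrite JE => /eqP <-; rewrite cycle_min_invol.
have incr j : j \in J -> w (pos j) < w (pos_succ j).
  by move=> jJ; have := step j; rewrite /cycle_lt Jbe // Jmin // !ltnn !eqxx.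
(* Equal minima mean the same cycle, so nothing is sorted between partners and 2-cycles occupy
   adjacent positions. *)
have between x z : cycle_lt be s x z -> cycle_lt be s z (s x) -> False.
  rewrite /cycle_lt bes cycle_min_invol // => h1 h2.
  have eq_m : cycle_min s x = cycle_min s z by lia.
  case: (cycle_min_eq sK eq_m) => def_z; move: h1 h2; rewrite def_z ?bes ?cycle_min_invol //; lia.
have Smin j : j \in S -> cycle_min s (w (pos_succ j)) < cycle_min s (w (pos j)).
  rewrite SE => /andP[njJ /eqP eq_be]; have := step j; rewrite /cycle_lt eq_be ltnn eqxx /=.
  case: ltngtP => //= eq_m lt_w; case: (cycle_min_eq sK (esym eq_m)).
    by move=> /(congr1 val) /=; lia.
  by move=> eq_s; rewrite JE -eq_s eqxx in njJ.
(* Otherwise its smaller partner comes earlier: at position [j], putting [j] in [J], or before it,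
   against the decreasing order of minima. *)
have Shead j : j \in S -> cycle_min s (w (pos_succ j)) = w (pos_succ j).
  move=> jS; have lt_min := Smin j jS; have := jS; rewrite SE => /andP[njJ /eqP eq_be].
  apply/eqP/negPn/negP => ne_min; pose y := s (w (pos_succ j)).
  have lt_y : y < w (pos_succ j) by move: ne_min; rewrite /cycle_min -/y; lia.
  have m_y : cycle_min s y = cycle_min s (w (pos_succ j)) by rewrite cycle_min_invol.
  have be_y : be y = be (w (pos_succ j)) by rewrite bes.
  have : cycle_lt be s y (w (pos_succ j)) by rewrite /cycle_lt be_y m_y lt_y !eqxx /= !orbT.
  rewrite -[y]wr sw /= ltnS leq_eqVlt => /orP[/eqP eq_r|lt_r].
    have eq_y : y = w (pos j) by rewrite -[LHS]wr; congr (w _); apply: val_inj.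
    by rewrite JE -eq_y sK eqxx in njJ.
  have : cycle_lt be s (w (r y)) (w (pos j)) by rewrite sw.
  by rewrite wr /cycle_lt be_y m_y eq_be; lia.
have subS : S \subset doubling_set J w.
  apply/fintype.subsetP => i iS; rewrite inE; have lt_min := Smin i iS; rewrite Shead // in lt_min.
  have le_min : cycle_min s (w (pos i)) <= w (pos i) by apply: geq_minl.
  have := iS; rewrite SE => /andP[-> _]; rewrite /descent (leq_trans lt_min) //=.
  case: (boolP (pred_in J i)) => //= /exists_inP[j jJ /eqP val_j].
  apply/exists_inP; exists j => //; have eq_p : pos_succ j = pos i by apply: val_inj.
  rewrite val_j eqxx -eq_p incr // andbT /=; apply: leq_trans lt_min _.
  by rewrite -eq_p -Jmin // geq_minl.
have inT : (J, w, S) \in marked_reps.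
  by rewrite inE /= ncJ subS andbT; apply/min_coset_repsP.
exists J, w, S; split=> //.
- have be_mono x y : x <= y -> be (w x) <= be (w y).
    rewrite leq_eqVlt => /orP[/eqP/val_inj->//|]; rewrite -sw /cycle_lt; lia.
  (* Both sides start at 0 and grow at the same positions; [be] is monotone along [w], and
     [initial_image] excludes jumps by more than 1. *)
  have lvl_w x : level_of J w S (w x) = be (w x).
    case: x => x; elim: x => [|x IHx] lt_xn.
      rewrite /level_of permK marks_before0 //; case def_c: (be _) => [//|c].
      have [y def_y] := init _ _ def_c; rewrite -(wr y) in def_y.
      by have := be_mono (Ordinal lt_xn) (r y) (leq0n _); rewrite def_c def_y ltnn.
    have lt_x : x < n.-1 by lia.
    rewrite (_ : Ordinal lt_xn = pos_succ (Ordinal lt_x)); last exact: val_inj.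
    rewrite level_of_pos_succ (_ : pos _ = Ordinal (ltnW lt_xn)) ?IHx; last exact: val_inj.
    set j := Ordinal lt_x; have eq_p : Ordinal (ltnW lt_xn) = pos j by apply: val_inj.
    rewrite eq_p finset.in_setU negb_or SE.
    case: (boolP (j \in J)) => [jJ|njJ] /=; first by rewrite addn0 Jbe.
    case: eqP => [->|/eqP ne_be]; first by rewrite addn0.
    have lt_be : be (w (pos j)) < be (w (pos_succ j)).
      by rewrite ltn_neqAle ne_be be_mono /=.
    case def_c: (be (w (pos_succ j))) lt_be => [//|c] lt_be.
    have [y def_y] := init _ _ def_c; rewrite -(wr y) in def_y.
    have le_y : r y <= pos j.
      rewrite leqNgt; apply/negP => lt_y; have := be_mono (pos_succ j) (r y) lt_y.
      by rewrite def_c def_y ltnn.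
    by have := be_mono _ _ le_y; rewrite def_y /=; lia.
  by move=> x; rewrite -(wr x) lvl_w.
apply/permP => x; rewrite involution_ofE // -(wr x) permK.
case: partnerP => [j jJ ->|j jJ ->|no1 no2].
- by apply/esym/eqP; rewrite -JE.
- by move: jJ; rewrite JE => /eqP <-; rewrite sK.
(* By [between], a moved [x] has its partner in an adjacent position; the index joining the two
   would lie in [J], against [no1] or [no2]. *)
apply/esym/eqP/negPn/negP; rewrite wr => ne_s.
have [lt_x|] := orP (cycle_lt_total be s ne_s); last first.
  rewrite -[s x]wr -{1}[x]wr sw => lt_r; have [j def_p val_j] := ex_pos lt_r.
  have xp : x = w (pos j) by rewrite def_p wr.
  have : j \in J.
    rewrite JE -xp; apply/negPn/negP => ne_z; apply: (@between x (w (pos_succ j))).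
      by rewrite xp sw.
    rewrite -[s x]wr sw ltn_neqAle /= val_j lt_r andbT.
    apply: contraNneq ne_z => eq_r; rewrite -[s x]wr; apply/eqP; congr (w _); apply: val_inj => /=.
    by rewrite val_j.
  by move=> /no1; rewrite def_p eqxx.
have : r (s x) < r x by rewrite -sw !wr.
move=> lt_r; have lt_n : (r x).-1 < n.-1 by have := ltn_ord (r x); lia.
pose j := Ordinal lt_n; have def_p : pos_succ j = r x by apply: val_inj => /=; lia.
have xp : x = w (pos_succ j) by rewrite def_p wr.
have : j \in J.
  rewrite JE -xp -[x in _ == x]sK (inj_eq (@perm_inj _ s)); apply/negPn/negP => ne_z.
  apply: (@between (s x) (w (pos j))); rewrite ?sK.
    rewrite -[s x]wr sw ltn_neqAle; apply/andP; split; last by rewrite /=; lia.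
    apply: contraNneq ne_z => eq_r; rewrite -[s x]wr; apply/eqP; congr (w _); exact: val_inj.
  by rewrite xp sw.
by move=> /no2; rewrite def_p eqxx.
Qed.

End SortedData.

(** * Classification and count of the orbits *)

Section Classification.

Variables (C : numClosedFieldType) (n : nat).
Local Notation family := (forall k : 'I_n.-1, 'M[C]_(ext_dim k.+1 n)).
Implicit Types (be : 'I_n -> nat) (s : 'S_n).

Definition normal_form be s : family := lim_fam be (perm_mx s).

Lemma blockwise_perm be s : (forall x, be (s x) = be x) -> blockwise be (perm_mx s : 'M[C]_n).
Proof.
by move=> bes i j; rewrite !mxE; case: (s i =P j) => [<-|]; rewrite ?bes ?eqxx.
Qed.

Lemma normal_form_neq0 be s k : (forall x, be (s x) = be x) -> normal_form be s k != 0.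
Proof. by move=> bes; apply: lim_fam_neq0; [apply: unitmx_perm | apply: blockwise_perm]. Qed.

Lemma normal_form_complete be s : (forall x, s (s x) = x) -> (forall x, be (s x) = be x) ->
  complete_quadrics C n (point_of (normal_form be s)).
Proof.
move=> sK bes; apply: lim_fam_complete; [| exact: unitmx_perm | exact: blockwise_perm].
by rewrite tr_perm_mx; congr perm_mx; apply/permP => x; apply: (@perm_inj _ s); rewrite permKV sK.
Qed.

Lemma complete_quadric_normal_form x : complete_quadrics C n x -> exists be, exists s,
  [/\ initial_image be, forall z, s (s z) = z, forall z, be (s z) = be z &
      borel_orbit x = borel_orbit (point_of (normal_form be s))].
Proof.
move=> [_ closx]; have [v [def_x nzv]] := multipointP closx.1; rewrite def_x in closx *.
have [h [be [d [uh be_mono init ud vE]]]] := closure_chart closx nzv.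
have [l [b [w [upl ul upb ub hE]]]] := Bruhat uh.
pose l0 := block_part be l; pose A1 := l0^T *m diag_mx d *m l0.
(* As [be] is nondecreasing, the lower triangular [l] meets the condition of [lim_ext_block], and
   only its diagonal blocks act on the limit. *)
have lbe i j : l i j != 0 -> (be j <= be i)%N.
  move=> nz; apply: be_mono; rewrite leqNgt; apply: contraNN nz => lt_ij.
  by have := upl j i lt_ij; rewrite mxE => ->.
have ul0 : l0 \in unitmx.
  rewrite -unitmx_tr; apply: upper_unitP => [i j lt_ji|i].
    by rewrite !mxE; case: ifP => // _; have := upl i j lt_ji; rewrite mxE.
  rewrite !mxE eqxx; have := upper_unit_diag i upl; rewrite unitmx_tr mxE; by move=> /(_ ul).
have bl0 : blockwise be l0.
  by move=> i j; rewrite mxE; case: (be i =P be j) => // _; rewrite eqxx.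
have bA1 : blockwise be A1.
  exact: blockwiseM (blockwiseM (blockwise_tr bl0) (@blockwise_diag C n be d)) bl0.
have uA1 : A1 \in unitmx by rewrite !unitmx_mul unitmx_tr ul0 ud.
have sA1 : A1^T = A1 by rewrite !trmx_mul trmxK tr_diag_mx mulmxA.
(* The transported levels need not be monotone any more; the remaining congruence [c] is blockwise
   for them and so still passes through the limit. *)
pose be' z := be (w^-1%g z); pose A2 : 'M[C]_n := (perm_mx w)^T *m A1 *m perm_mx w.
have Pbe i j : (perm_mx w : 'M[C]_n) i j != 0 -> be i = be' j.
  by rewrite !mxE /be'; case: (w i =P j) => [<-|]; rewrite ?permK ?eqxx.
have bA2 : blockwise be' A2.
  move=> i j /mulmx_neq0[q /mulmx_neq0[p]]; rewrite [_^T _ _]mxE => /Pbe <- /bA1 ->.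
  by move=> /Pbe.
have uA2 : A2 \in unitmx by rewrite unitmx_mul unitmx_perm andbT unitmx_mul uA1 andbT unitmx_tr unitmx_perm.
have sA2 : A2^T = A2 by rewrite trmx_mul trmx_mul trmxK sA1 mulmxA.
have [c [s [upc uc bc sK sE]]] := sym_normal_form sA2 uA2 bA2.
have bes z : be' (s z) = be' z.
  have bP : blockwise be' (perm_mx s : 'M[C]_n).
    by rewrite -sE; exact: blockwiseM (blockwiseM (blockwise_tr bc) bA2) bc.
  by apply/esym/bP; rewrite !mxE eqxx oner_eq0.
exists be', s; split=> //.
  by move=> z m /init[y def_y]; exists (w y); rewrite /be' permK.
apply/borel_orbit_eq => //; first by move=> k; apply: normal_form_neq0.
have lE : cong_fam l (lim_fam be (diag_mx d)) = lim_fam be A1.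
  by apply: functional_extensionality_dep => k; apply: lim_ext_block.
have wE : cong_fam (perm_mx w) (lim_fam be A1) = lim_fam be' A2.
  by apply: functional_extensionality_dep => k; apply: lim_ext_cong => //; apply: unitmx_perm.
have cE : cong_fam c (lim_fam be' A2) = normal_form be' s.
  rewrite /normal_form -sE.
  by apply: functional_extensionality_dep => k; apply: lim_ext_cong.
exists (invmx c *m b); split.
- by apply: upper_mxM => //; apply: upper_mx_inv.
- by rewrite unitmx_mul unitmx_inv uc.
by rewrite vE hE -cE cong_famM mulmxA mulmxV // mul1mx -wE -lE !cong_famM ?mulmxA.
Qed.

Lemma normal_form_orbit_inj be be' s s' : initial_image be -> initial_image be' ->
  (forall x, be (s x) = be x) -> (forall x, be' (s' x) = be' x) ->
  borel_orbit (point_of (normal_form be s)) = borel_orbit (point_of (normal_form be' s')) ->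
  be =1 be' /\ s = s'.
Proof.
move=> init init' bes bes' /borel_orbit_eq[k||h [uph uh eq_pt]].
- exact: normal_form_neq0.
- by move=> k; apply: normal_form_neq0.
exact: (lim_fam_unique init init' bes bes' uph uh eq_pt).
Qed.

Definition orbit_of (t : {set 'I_n.-1} * 'S_n * {set 'I_n.-1}) :=
  borel_orbit (point_of (normal_form (level_of t.1.1 t.1.2 t.2) (involution_of t.1.1 t.1.2))).

Lemma orbit_of_inj : {in marked_reps n &, injective orbit_of}.
Proof.
move=> [[J w] S] [[J' w'] S'] tT tT' /=; have := tT; have := tT'.
rewrite !inE /= => /and3P[ncJ' _ _] /and3P[ncJ _ _] /normal_form_orbit_inj[].
- exact: level_of_initial.
- exact: level_of_initial.
- by move=> x; apply: level_of_involution.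
- by move=> x; apply: level_of_involution.
exact: marked_reps_inj.
Qed.

Lemma borel_orbitsE : borel_orbits C n = (orbit_of @` [set` marked_reps n])%classic.
Proof.
rewrite predeqE => X; split=> [[x cx <-]|[[[J w] S] /= tT <-]].
  have [be [s [init sK bes ->]]] := complete_quadric_normal_form cx.
  have [J [w [S [tT lvl inv]]]] := marked_reps_ex init sK bes.
  by exists (J, w, S) => //=; rewrite /orbit_of /= (boolp.funext lvl) inv.
have := tT; rewrite inE /= => /and3P[ncJ _ _].
exists (point_of (normal_form (level_of J w S) (involution_of J w))) => //.
apply: normal_form_complete => x; first exact: involution_ofK.
exact: level_of_involution.
Qed.

Lemma card_borel_orbits : (borel_orbits C n #= `I_#|marked_reps n|)%card.
Proof.
pose t0 : {set 'I_n.-1} * 'S_n * {set 'I_n.-1} := (finset.set0, 1%g, finset.set0).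
pose f m := orbit_of (nth t0 (enum (marked_reps n)) m).
have nth_in m : (m < #|marked_reps n|)%N -> nth t0 (enum (marked_reps n)) m \in marked_reps n.
  by move=> lt_m; rewrite -mem_enum mem_nth // -cardE.
have -> : borel_orbits C n = (f @` `I_#|marked_reps n|)%classic.
  rewrite borel_orbitsE predeqE => X; split=> [[t tT <-]|[m lt_m <-]].
    exists (index t (enum (marked_reps n))); last by rewrite /f nth_index // mem_enum.
    by rewrite /= cardE index_mem mem_enum.
  by exists (nth t0 (enum (marked_reps n)) m) => //=; apply: nth_in.
apply: inj_card_eq => m m'; rewrite !inE => lt_m lt_m' /orbit_of_inj eq_t.
apply/eqP; rewrite -(nth_uniq t0 _ _ (enum_uniq (marked_reps n))) -?cardE //.
by rewrite eq_t // nth_in.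
Qed.

End Classification.

Theorem theorem1p3 (R : realType) (n : nat) (n_ge1 : (1 <= n)%N) :
  (borel_orbits R[i] n #=
    `I_(\sum_(J : {set 'I_n.-1} | no_consecutive J)
          \sum_(w in min_coset_reps J) 2 ^ (a_stat J w + b_stat J w))%N)%card.
Proof. by rewrite -card_marked_reps; apply: card_borel_orbits. Qed.
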